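(* Let $H_1=\{(0,b,1)\in{\cal L}\}$ and $H_2=\{(0,b+1,b+2)\in{\cal L}: b\ge1,\ c_b>0,\ c_{b+1}=0\}$. For $z=(0,b+1,b+2)\in H_2$ let $$r(b)=\max\{j\ge1: c_{b+1}=\dots=c_{b+j}=0\},$$ $$\rho(b)=Q\big((0,b+r(b),b+r(b)+1),(0,b+r(b)+1,1)\big)=\frac{\varphi_C(1)}{\lambda_C\,\varphi_C(b+r(b)+1)},$$ $$h(b,k)=\begin{cases}0&k<r(b)+1\\ 1-\rho(b)&k=r(b)+1\\ \rho(b)\,\lambda_C^{-(k-r(b)-2)}(1-\lambda_C^{-1})&k>r(b)+1.\end{cases}$$ Let $\nu(k)=\lambda_C^{-(k-1)}(1-\lambda_C^{-1})$ and $M_{\pi^Q_1}=\sum_xx\,\pi^Q_1(x)$, and write $z(2)$ for the second coordinate of $z\in{\cal L}$. Then: 1. $\displaystyle\lim_{n\to\infty}\frac1nE^{Q_n}N_n=M_{\pi^Q_1}$. 2. $$\lim_{n\to\infty}\mu_n(0)=1-\frac{1-\pi^Q_1(0)}{M_{\pi^Q_1}},$$ $$\lim_{n\to\infty}\mu_n(1)=\frac{1-\pi^Q_1(0)-\pi^Q(H_1)(1-\lambda_C^{-1})-\sum_{z\in H_2}\pi^Q(z)\left(1-\rho(z(2)-1)\right)}{M_{\pi^Q_1}}.$$ 3. For $k\ge2$, $$\lim_{n\to\infty}\mu_n(k)=\frac{(1-\lambda_C^{-1})\,\pi^Q(H_1)\,\nu(k-1)+\sum_{z\in H_2}\pi^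Q(z)\left(h(z(2)-1,k)-\rho(z(2)-1)\,\nu(k-1)\right)}{M_{\pi^Q_1}}.$$
   Context: $\mathbb{Z}_+=\{0,1,\dots\}$. Fix $L\in\mathbb{N}$ and $c_1,\dots,c_L\in\mathbb{Z}_+$ with $c_1c_L>0$ and $(L,c_1)\ne(1,1)$. The positive linear recursion $(G_n)_{n\ge1}$ is: $G_1=1$; $G_{n+1}=c_1G_n+c_2G_{n-1}+\dots+c_nG_1+1$ for $1\le n\le L-1$; $G_{n+1}=\sum_{j=1}^Lc_jG_{n+1-j}$ for $n\ge L$. An expression $N=\sum_{i=1}^na_iG_{n+1-i}$ with $a_1\in\mathbb{N}$, $a_2,\dots,a_n\in\mathbb{Z}_+$ is a legal decomposition of length $n$ if either (i) $n<L$ and $a_i=c_i$ for $1\le i\le n$; or (ii) there is $s\in\{1,\dots,L\}$ with $a_1=c_1,\dots,a_{s-1}=c_{s-1}$, $a_s<c_s$, $a_{s+1}=\dots=a_{s+\ell}=0$ for some $\ell\ge0$, and $(a_{s+\ell+i})_{i=1}^{n-s-\ell}$ is either (the digit sequence of) a legal decomposition or empty. It is known that every positive integer has a unique legal decomposition, and the integers in $[G_n,G_{n+1})$ are exactly those whose legal decomposition has length $n$. $Q_n$ ($n\in\mathbb{Z}_+$) denotes the uniform distribution on the integers $N\in[G_{n+1},G_{n+2})$, with expectation $E^{Q_n}$; the legal decomposition of such $N$ is written $N=\sum_{j=0}^nX_jG_{n+1-j}$. Gaps: a digit $X_j>0$ contributes $X_j-1$ gaps of length $0$, and, if there is a later nonzero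 digit, one gap of length $\min\{k\ge1:X_{j+k}>0\}$. $N_n(k)$ denotes the number of gaps of length $k$: $N_n(0)=\sum_{j=0}^{n-1}\max(X_j-1,0)$ and, for $k\ge1$, $N_n(k)=\#\{0\le j\le n-k:X_j>0,\ X_{j+1}=\dots=X_{j+k-1}=0,\ X_{j+k}>0\}$. $N_n=\sum_{k\ge0}N_n(k)$ and $\mu_n(k)=E^{Q_n}N_n(k)/E^{Q_n}N_n$ (for $n$ large enough that the denominator is positive). Let $${\cal L}=\{(x,j,j'): (x<c_j \text{ and } j'=1)\text{ or }(j<L,\ x=c_j,\ j'=j+1)\},$$ with $x\in\{0,\dots,\max_ic_i\}$, $j,j'\in\{1,\dots,L\}$. $P_{\cal L}$ is the ${\cal L}\times{\cal L}$ matrix with entry $\frac{1}{(\max_ic_i+1)L}$ at $(z,z')$ if the third coordinate of $z$ equals the second coordinate of $z'$, and $0$ otherwise; it is irreducible and aperiodic. $\lambda_c$ is its Perron eigenvalue, with positive left and right eigenvectors $\nu_c,\varphi_c$ normalized so that $\varphi_c$ and $\nu_c\varphi_c$ are probability distributions on ${\cal L}$. $Q(z,z')=\frac{1}{\lambda_c\varphi_c(z)}P_{\cal L}(z,z')\varphi_c(z')$ is an irreducible aperiodic stochastic matrix with stationary distribution $\pi^Q=\nu_c\varphi_c$; $\pi^Q_1(x)=\sum_{b,b'}\pi^Q(x,b,b')$. $C$ is the $L\times L$ matrix with $C_{i,1}=c_i$, $C_{i,i+1}=1$ for $1\le i\le L-1$, all other entries $0$ ($C=(c_1)$ if $L=1$);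 $\lambda_C$ is its Perron eigenvalue and $\varphi_C$ a positive right eigenvector. *)

(* Defs.v *)
From HB Require Import structures.
From mathcomp Require Import all_boot all_order all_algebra.
From mathcomp Require Import complex.
From mathcomp Require Import all_classical all_reals all_analysis.

Set Implicit Arguments.
Unset Strict Implicit.
Unset Printing Implicit Defensive.

Import Order.TTheory GRing.Theory Num.Theory.
Import numFieldNormedType.Exports.

Local Open Scope ring_scope.

(* The coefficients are c 1, ..., c L.  The values of c at 0 and above L are
   never used.  Likewise G 0 is never used. *)

Definition positive_linear_recursion (L : nat) (c G : nat -> nat) : Prop :=
  [/\ G 1%N = 1%N,
      forall n, (1 <= n < L)%N ->
        G n.+1 = (\sum_(1 <= j < n.+1) c j * G (n.+1 - j) + 1)%N
    & forall n, (L <= n)%N ->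
        G n.+1 = (\sum_(1 <= j < L.+1) c j * G (n.+1 - j))%N].

(* The digits c_1, ..., c_{s-1}, x, followed by l zeros. *)
Definition block (c : nat -> nat) (s x l : nat) : seq nat :=
  [seq c i | i <- iota 1 s.-1] ++ x :: nseq l 0%N.

(* Digit sequences, most significant digit first.  The last two constructors
   separate the cases of an empty and of a nonempty remainder after a block. *)
Inductive legal (L : nat) (c : nat -> nat) : seq nat -> Prop :=
| legal_short n :
    (0 < n < L)%N -> (0 < c 1%N)%N -> legal L c [seq c i | i <- iota 1 n]
| legal_last s x l :
    (1 <= s <= L)%N -> (x < c s)%N -> (0 < head 0%N (block c s x l))%N ->
    legal L c (block c s x l)
| legal_next s x l a :
    (1 <= s <= L)%N -> (x < c s)%N -> (0 < head 0%N (block c s x l))%N ->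
    legal L c a -> legal L c (block c s x l ++ a).

Definition legal_decomposition
    (L : nat) (c G : nat -> nat) (N : nat) (a : seq nat) : Prop :=
  legal L c a /\
  N = (\sum_(0 <= i < size a) nth 0 a i * G (size a - i))%N.

(* The digit X_j, indexed from 0, of the legal decomposition of N.  Legal
   decompositions of positive integers exist and are unique, so the choice
   made by xget is forced when N > 0. *)
Definition digit (L : nat) (c G : nat -> nat) (N j : nat) : nat :=
  nth 0%N (xget [::] (legal_decomposition L c G N)) j.

(* The expectation of f under the uniform distribution on [G_{n+1}, G_{n+2}). *)
Definition expectationQ (R : realType) (G : nat -> nat) (n : nat)
    (f : nat -> R) : R :=
  (\sum_(G n.+1 <= N < G n.+2) f N) / (G n.+2 - G n.+1)%N%:R.

(* For k = 0 the last digit X_n is left out of the sum; for k > n the count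
   ranges over the empty sequence. *)
Definition gaps_of_length (n : nat) (X : nat -> nat) (k : nat) : nat :=
  if k == 0%N then (\sum_(0 <= j < n) maxn (X j - 1) 0)%N
  else count (fun j => [&& (0 < X j)%N,
                           all (fun i => X (j + i)%N == 0%N) (iota 1 k.-1)
                         & (0 < X (j + k)%N)%N])
             (iota 0 (n.+1 - k)).

Lemma gaps_of_length_gt n X k : (n < k)%N -> gaps_of_length n X k = 0%N.
Proof.
case: k => // k lt_nk; rewrite /gaps_of_length /=.
by move: lt_nk; rewrite -subn_eq0 => /eqP ->.
Qed.

(* The sum over all k >= 0, by gaps_of_length_gt. *)
Definition gaps (n : nat) (X : nat -> nat) : nat :=
  (\sum_(0 <= k < n.+1) gaps_of_length n X k)%N.

Definition mean_gaps_of_length (R : realType) (L : nat) (c G : nat -> nat)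
    (n k : nat) : R :=
  expectationQ G n (fun N => (gaps_of_length n (digit L c G N) k)%:R).

Definition mean_gaps (R : realType) (L : nat) (c G : nat -> nat)
    (n : nat) : R :=
  expectationQ G n (fun N => (gaps n (digit L c G N))%:R).

Definition mu (R : realType) (L : nat) (c G : nat -> nat) (n k : nat) : R :=
  mean_gaps_of_length R L c G n k / mean_gaps R L c G n.

Definition cmax (L : nat) (c : nat -> nat) : nat :=
  (\max_(1 <= i < L.+1) c i)%N.

(* The second and third coordinates live in 'I_L.+1 with 0 excluded, so that
   their values are exactly 1, ..., L. *)
Definition in_calL (L : nat) (c : nat -> nat)
    (t : 'I_(cmax L c).+1 * 'I_L.+1 * 'I_L.+1) : bool :=
  let: (x, j, j') := t in
  [&& (0 < j)%N, (0 < j')%N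
    & ((x < c j)%N && (j' == 1%N :> nat))
      || [&& (j < L)%N, x == c j :> nat & j' == j.+1 :> nat]].

Definition calL (L : nat) (c : nat -> nat) : finType :=
  {t : 'I_(cmax L c).+1 * 'I_L.+1 * 'I_L.+1 | in_calL t}.

Definition coord1 (L : nat) (c : nat -> nat) (z : calL L c) : nat :=
  (val z).1.1.
Definition coord2 (L : nat) (c : nat -> nat) (z : calL L c) : nat :=
  (val z).1.2.
Definition coord3 (L : nat) (c : nat -> nat) (z : calL L c) : nat :=
  (val z).2.

(* The element of calL with the given coordinates, if there is one. *)
Definition mk_calL (L : nat) (c : nat -> nat) (x j j' : nat) :
    option (calL L c) :=
  [pick z | [&& coord1 z == x, coord2 z == j & coord3 z == j']].

Definition P_calL (R : realType) (L : nat) (c : nat -> nat) :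
    'M[R]_#|{: calL L c}| :=
  \matrix_(i, k)
    if coord3 (enum_val i) == coord2 (enum_val k)
    then (((cmax L c).+1 * L)%N%:R)^-1 else 0.

(* The row index i and the column index k stand for i.+1 and k.+1. *)
Definition companion (R : realType) (L : nat) (c : nat -> nat) : 'M[R]_L :=
  \matrix_(i < L, k < L)
    if k == 0%N :> nat then (c i.+1)%:R
    else if k == i.+1 :> nat then 1 else 0.

(* For a nonnegative irreducible matrix: the positive real eigenvalue that
   dominates all complex eigenvalues in modulus. *)
Definition perron_eigenvalue (R : realType) (n : nat) (A : 'M[R]_n) (lam : R) :
    Prop :=
  [/\ 0 < lam, eigenvalue A lam
    & forall m : R[i], eigenvalue (map_mx (real_complex R) A) m ->
        `|m| <= real_complex R lam].

Definition Qmx (R : realType) (L : nat) (c : nat -> nat) (lamc : R)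
    (phic : 'cV[R]_#|{: calL L c}|) (z z' : calL L c) : R :=
  (lamc * phic (enum_rank z) 0)^-1
  * P_calL R L c (enum_rank z) (enum_rank z') * phic (enum_rank z') 0.

Definition piQ (R : realType) (L : nat) (c : nat -> nat)
    (nuc : 'rV[R]_#|{: calL L c}|) (phic : 'cV[R]_#|{: calL L c}|)
    (z : calL L c) : R :=
  nuc 0 (enum_rank z) * phic (enum_rank z) 0.

Definition piQ1 (R : realType) (L : nat) (c : nat -> nat)
    (nuc : 'rV[R]_#|{: calL L c}|) (phic : 'cV[R]_#|{: calL L c}|)
    (x : nat) : R :=
  \sum_(z : calL L c | coord1 z == x) piQ nuc phic z.

Definition M_piQ1 (R : realType) (L : nat) (c : nat -> nat)
    (nuc : 'rV[R]_#|{: calL L c}|) (phic : 'cV[R]_#|{: calL L c}|) : R :=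
  \sum_(x < (cmax L c).+1) x%:R * piQ1 nuc phic x.

Definition H1 (L : nat) (c : nat -> nat) : {set calL L c} :=
  [set z | (coord1 z == 0%N) && (coord3 z == 1%N)].

(* The parameter b of the element (0, b + 1, b + 2) is (coord2 z).-1. *)
Definition H2 (L : nat) (c : nat -> nat) : {set calL L c} :=
  [set z | let b := (coord2 z).-1 in
     [&& coord1 z == 0%N, coord2 z == b.+1, coord3 z == b.+2,
         (1 <= b)%N, (0 < c b)%N & c b.+1 == 0%N]].

(* The indices b + 1, ..., b + j have to stay in {1, ..., L}. *)
Definition zero_run (L : nat) (c : nat -> nat) (b : nat) : nat :=
  (\max_(1 <= j < L.+1 |
         (b + j <= L) && all (fun i => c (b + i) == 0) (iota 1 j)) j)%N.

(* Both elements of calL exist when b comes from an element of H2. *)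
Definition rho (R : realType) (L : nat) (c : nat -> nat) (lamc : R)
    (phic : 'cV[R]_#|{: calL L c}|) (b : nat) : R :=
  let r := zero_run L c b in
  match mk_calL L c 0 (b + r) (b + r + 1), mk_calL L c 0 (b + r + 1) 1 with
  | Some z, Some z' => Qmx lamc phic z z'
  | _, _ => 0
  end.

(* Meant for k >= 1. *)
Definition nu (R : realType) (lamC : R) (k : nat) : R :=
  lamC ^- (k - 1) * (1 - lamC^-1).

Definition h (R : realType) (L : nat) (c : nat -> nat) (lamc : R)
    (phic : 'cV[R]_#|{: calL L c}|) (lamC : R) (b k : nat) : R :=
  let r := zero_run L c b in
  if (k < r + 1)%N then 0
  else if k == (r + 1)%N then 1 - rho lamc phic b
  else rho lamc phic b * lamC ^- (k - r - 2) * (1 - lamC^-1).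

(* Main.v *)
Require Import Defs.
From HB Require Import structures.
From mathcomp Require Import all_boot all_order all_algebra.
From mathcomp Require Import complex.
From mathcomp Require Import all_classical all_reals all_analysis.
From mathcomp Require Import zify ring lra.

Set Implicit Arguments.
Unset Strict Implicit.
Unset Printing Implicit Defensive.

Import Order.TTheory GRing.Theory Num.Theory.
Import numFieldNormedType.Exports.

Local Open Scope classical_set_scope.
Local Open Scope ring_scope.

(** Reading a digit sequence from left to right, keep a state in {1, ..., L}:
in state j a digit below [c j] leads back to state 1, and the digit [c j] leads
to state j + 1 if j < L.  Legal decompositions are the sequences readable from
state 1 whose first digit is positive, and the elements of [calL] are the edges
(digit, state, next state) of this automaton.  In lexicographic order the words
of length n readable from state 1 have the values 0, ..., G (n + 1) - 1
([value_words]).  Hence the mean over [G (n + 1), G (n + 2)) is the mean over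
the words of length n + 1 whose first digit is positive
([expectationQ_words]).

Sums over words obey linear recursions driven by the operator
[step f i = c i * f 1 + f (i + 1)], whose matrix is the companion matrix.  Let u
and v be its positive right and left eigenvectors and lam its eigenvalue.  Since
state 1 can be reached from every state in exactly L steps, L steps contract
the oscillation of f / u ([iter_step_contracts]), so that [step ^ n f / lam ^ n]
converges to the multiple of u that has the same pairing with v as f
([iter_step_cvg]).  A functional of words that adds up one contribution per
position satisfies the recursion of [step] with a forcing term.  Its pairing
with v is a plain sum, to which the lemma of Cesaro applies, and its oscillation
stays bounded, so that all its entries have the same mean growth up to the
factor u ([forced_cvg]).  The outcome, [mean_total_cvg], is that the mean of
such a functional per digit tends to its expectation in the stationary chain,
where the edge (x, j, j') has the probability v j * u j' / lam ^ 2.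

The digit sum and the numbers of gaps of a given length are functionals of
this kind, and the total number of gaps differs from the digit sum by a bounded
amount ([gaps_sumn]).  A digit x contributes max (x - 1, 0) gaps of length 0,
and starts a gap of length k + 1 if it is positive and followed by exactly k
zeros and a positive digit; [gap_density] is the asymptotic share of the words
with such a beginning.

It remains to follow the zeros.  From a state i with [c i > 0] the digit 0 leads
to state 1, and there each further zero has probability 1 / lam.  From a state i
with [c i = 0] the only digit is 0 and the next state is i + 1, so that zeros
are forced until the run of zero coefficients ends.  The elements of [H1] are
the zeros of the first kind, those of [H2] are the first zeros of the runs.
Summation by parts along the runs ([zero_runs_flow], [sum_run_starts]) replaces
the ends of the runs, where zeros of the first kind may continue a gap, by
their starts, and this gives the stated limits.

The eigenvectors of [P_calL] yield u and v: by their equations [phic] depends on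
the third coordinate only and [nuc] on the second, and summing them over the
edges that leave, or enter, a state gives u and v ([right_vec_right],
[left_vec_left]). *)

(** * Words read by the automaton *)

Lemma uniq_map_inj (T1 T2 : eqType) (f : T1 -> T2) (s : seq T1) :
  uniq (map f s) -> {in s &, injective f}.
Proof.
elim: s => //= x s IHs /andP[fx us] y z; rewrite !inE.
case/predU1P=> [->|ys] /predU1P[->|zs] //; last exact: IHs.
  by move=> fE; rewrite fE map_f in fx.
by move=> fE; rewrite -fE map_f in fx.
Qed.

Section Words.
Local Open Scope nat_scope.
Variables (L : nat) (c : nat -> nat).

(** State i is reached inside a block after c 1, ..., c (i - 1): a digit below
[c i] closes the block, and the digit [c i] prolongs it. *)
Fixpoint admissible (i : nat) (w : seq nat) : bool :=
  if w is x :: w' then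
    (x < c i) && admissible 1 w' ||
    [&& i < L, x == c i & admissible i.+1 w']
  else true.

(** The order is lexicographic, which makes the values of the words
increasing. *)
Fixpoint words (n i : nat) : seq (seq nat) :=
  if n is m.+1 then
    [seq x :: w | x <- iota 0 (c i), w <- words m 1] ++
    (if i < L then [seq c i :: w | w <- words m i.+1] else [::])
  else [:: [::]].

Lemma mem_words n i w :
  (w \in words n i) = (size w == n) && admissible i w.
Proof.
elim: n i w => [|n IHn] i [|x w] //=.
- rewrite mem_cat; case: allpairsP => [[[? ?] [_ _ //]]|_] /=.
  by case: ifP => // _; apply/mapP => -[].
rewrite eqSS mem_cat.
have -> : (x :: w \in [seq y :: v | y <- iota 0 (c i), v <- words n 1]) =
    (x < c i) && (w \in words n 1).
  apply/allpairsP/andP => [[[y v] /= [yi vn [-> ->]]]|[xc wn]].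
    by move: yi; rewrite mem_iota.
  by exists (x, w); rewrite /= mem_iota.
rewrite IHn; case: (ltnP i L) => iL /=.
  have -> : (x :: w \in [seq c i :: v | v <- words n i.+1]) =
      (x == c i) && (w \in words n i.+1).
    apply/mapP/andP => [[v vn [-> ->]]|[/eqP -> wn]]; first by rewrite eqxx.
    by exists w.
  by rewrite IHn; case: (size w == n); rewrite ?andbT ?andbF.
by rewrite !orbF; case: (size w == n); rewrite ?andbT ?andbF.
Qed.

Lemma size_wordsS n i :
  size (words n.+1 i) =
  c i * size (words n 1) + (if i < L then size (words n i.+1) else 0).
Proof.
by rewrite /= size_cat size_allpairs size_iota; case: ifP; rewrite ?size_map.
Qed.

(** Along the one word c i, c (i + 1), ... that moves on to the next state at
every digit, each departure by a smaller digit falls back to state 1. *)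
Lemma size_words_unfold m n i : i + m <= L ->
  size (words (n + m) i) =
  \sum_(0 <= j < m) c (i + j) * size (words (n + m - j.+1) 1) +
  size (words n (i + m)).
Proof.
elim: m i => [|m IHm] i iL; first by rewrite big_nil !addn0.
rewrite addnS size_wordsS (_ : i < L); last by lia.
rewrite (IHm i.+1); last by lia.
rewrite big_nat_recl // addn0 subSS subn0 addnA addSnnS; congr (_ + _ + _).
by apply: eq_bigr => j _; rewrite addSnnS !subSS.
Qed.

(** For n < L the unfolding consumes the word entirely and leaves the empty
word, the summand 1 of the recursion; otherwise it stops in state L, where the
only digits are those below [c L]. *)
Lemma size_words_recursion G n : 0 < L ->
  positive_linear_recursion L c G -> size (words n 1) = G n.+1.
Proof.
move=> L_gt0 [G1 Gshort Glong].
elim/ltn_ind: n => n IHn.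
have [->|n_gt0] := posnP n; first by rewrite G1.
have [nL|Ln] := ltnP n L.
  rewrite Gshort ?n_gt0 // -{1}[n]add0n size_words_unfold //=.
  rewrite big_add1 /=; congr (_ + _).
  rewrite !big_nat; apply: eq_bigr => j /= jn.
  by rewrite IHn 1?add1n; [congr (_ * G _); lia | lia].
rewrite Glong // -{1}(subnK (_ : L.-1 <= n)); last by lia.
rewrite size_words_unfold; last by lia.
rewrite (_ : n - L.-1 = (n - L).+1); last by lia.
rewrite size_wordsS ifN; last by lia.
rewrite addn0 big_add1 -(prednK L_gt0) big_nat_recr //=; congr (_ + _).
  rewrite !big_nat; apply: eq_bigr => j /= jn.
  by rewrite IHn 1?add1n; [congr (_ * G _); lia | lia].
by rewrite IHn; [rewrite add1n; congr (_ * G _); lia | lia].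
Qed.

Lemma cons_zeros w :
  exists l a, w = nseq l 0 ++ a /\ (a = [::] \/ 0 < head 0 a).
Proof.
elim: w => [|[|x] w [l [a [-> ha]]]]; first by exists 0, [::]; split; [|left].
  by exists l.+1, a.
by exists 0, (x.+1 :: nseq l 0 ++ a); split; [|right].
Qed.

Lemma admissible_zeros l a : 0 < c 1 ->
  admissible 1 (nseq l 0 ++ a) = admissible 1 a.
Proof.
move=> c1; elim: l => //= l ->; rewrite c1 /= [0 == _]ltn_eqF //.
by rewrite andbF orbF.
Qed.

(** The last digit of the block leads to state 1, and the zeros that follow
stay there because 0 < c 1. *)
Lemma admissible_cat_block i s x l a : 0 < c 1 -> 0 < i <= s -> s <= L -> x < c s ->
  admissible i ([seq c j | j <- iota i (s - i)] ++ x :: nseq l 0 ++ a) =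
  admissible 1 a.
Proof.
move=> c1 + sL xc; move sE : (s - i) => m; elim: m i sE => [|m IHm] i sE si.
  have -> : i = s by lia.
  by rewrite /= xc admissible_zeros //= (ltn_eqF xc) andbF orbF.
by rewrite /= ltnn eqxx (_ : i < L) ?IHm //=; lia.
Qed.

Lemma admissible_prefix i n : 0 < i -> i + n <= L ->
  admissible i [seq c j | j <- iota i n].
Proof.
elim: n i => //= n IHn i i_gt0 inL; rewrite eqxx (_ : i < L) ?IHn ?orbT //; lia.
Qed.

Lemma legal_admissible a : 0 < c 1 ->
  legal L c a -> admissible 1 a /\ 0 < head 0 a.
Proof.
move=> c1; elim=> [n nL _|s x l sL xc hd|s x l b sL xc hd _ [adb _]].
- by split; [apply: admissible_prefix; lia|case: n nL].
- split => //; rewrite /block -[nseq l 0]cats0 -subn1.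
  by case/andP: sL => s0 sL; rewrite admissible_cat_block ?s0.
split; last by move: hd; rewrite /block; case: [seq _ | _ <- _].
by case/andP: sL => s0 sL; rewrite /block -catA -subn1 admissible_cat_block ?s0.
Qed.

(** The digits c 1, ..., c (i - 1) read on the way to state i belong to the
block under construction, so the induction has to keep them as a prefix.  The
zeros after a closing digit go into the block as well, since a legal remainder
starts with a positive digit. *)
Lemma legal_of_admissible i w : 0 < c 1 -> 0 < i <= L ->
  0 < head 0 ([seq c j | j <- iota 1 i.-1] ++ w) ->
  admissible i w -> legal L c ([seq c j | j <- iota 1 i.-1] ++ w).
Proof.
move=> c1; have [n] := ubnP (size w); elim: n i w => // n IHn i w wn iL.
case: w wn => [|x w] /= wn hd.
  rewrite cats0 => _; apply: legal_short => //.
  by case: i iL hd => [|[]].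
have blockE l a : w = nseq l 0 ++ a ->
    [seq c j | j <- iota 1 i.-1] ++ x :: w = block c i x l ++ a.
  by move=> ->; rewrite /block -catA.
case/orP => [/andP[xc]|/and3P[iL' /eqP xE]].
  have [l [a [wE ha]]] := cons_zeros w.
  rewrite {1}wE admissible_zeros // => ada.
  have hb : 0 < head 0 (block c i x l).
    by move: hd; rewrite /block; case: [seq _ | _ <- _].
  rewrite (blockE _ _ wE); case: ha => [->|ha].
    by rewrite cats0; apply: legal_last.
  apply: legal_next => //.
  apply: (IHn 1 a) => //; last by case/andP: iL; lia.
  by move: wn; rewrite wE size_cat; lia.
have iE : [seq c j | j <- iota 1 i.-1] ++ x :: w =
    [seq c j | j <- iota 1 i.+1.-1] ++ w.
  rewrite /= -[in iota 1 i](prednK (_ : 0 < i)); last by lia.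
  rewrite -[i.-1.+1]addn1 iotaD map_cat /= -catA /= xE.
  by rewrite add1n prednK //; lia.
rewrite iE in hd *; move=> adw; apply: IHn => //; lia.
Qed.

End Words.

(** * Values of words and legal decompositions *)

Section Values.
Local Open Scope nat_scope.
Variables (L : nat) (c G : nat -> nat).
Hypotheses (L_gt0 : 0 < L) (c1_gt0 : 0 < c 1).
Hypothesis recG : positive_linear_recursion L c G.

Definition value (w : seq nat) : nat :=
  \sum_(0 <= i < size w) nth 0 w i * G (size w - i).

Lemma value_cons x w : value (x :: w) = x * G (size w).+1 + value w.
Proof. by rewrite /value /= big_nat_recl // subn0. Qed.

(** The words with first digit x begin at the value x * G (n + 1), which is
where the words with first digit x - 1 end, because there are G (n + 1) words
of length n from state 1. *)
Lemma value_words n i : map value (words L c n i) = iota 0 (size (words L c n i)).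
Proof.
elim: n i => [|n IHn] i; first by rewrite /= /value big_nil.
have sizeE j w : w \in words L c n j -> size w = n.
  by rewrite mem_words => /andP[/eqP].
have mapE x j : map value [seq x :: w | w <- words L c n j] =
    iota (x * G n.+1) (size (words L c n j)).
  rewrite -map_comp -[x * _]addn0 iotaDl -IHn -map_comp.
  by apply/eq_in_map => w /sizeE /= <-; rewrite value_cons.
have mapsE m : map value [seq x :: w | x <- iota 0 m, w <- words L c n 1] =
    iota 0 (m * G n.+1).
  elim: m => [//|m IHm].
  rewrite -[in iota 0 m.+1]addn1 iotaD allpairs_cat map_cat IHm /= cats0 mapE.
  by rewrite (size_words_recursion _ L_gt0 recG) add0n mulSnr iotaD add0n.
rewrite size_wordsS /= map_cat mapsE.
rewrite (size_words_recursion _ L_gt0 recG) iotaD; congr (_ ++ _).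
by case: ifP => // _; rewrite mapE.
Qed.

Definition leading_words n : seq (seq nat) :=
  [seq x :: w | x <- iota 1 (c 1).-1, w <- words L c n 1] ++
  (if 1 < L then [seq c 1 :: w | w <- words L c n 2] else [::]).

Lemma words1_split n :
  words L c n.+1 1 = map (cons 0) (words L c n 1) ++ leading_words n.
Proof. by rewrite /= -[in iota 0 _](prednK c1_gt0) /= -catA. Qed.

Lemma leading_words_head n w : w \in leading_words n -> 0 < head 0 w.
Proof.
rewrite mem_cat => /orP[/allpairsP[[x v] /= [+ _ ->]]|].
  by rewrite mem_iota => /andP[].
by case: ifP => // _ /mapP[v _ ->].
Qed.

Lemma mem_leading_words n w :
  (w \in leading_words n) =
  [&& size w == n.+1, admissible L c 1 w & 0 < head 0 w].
Proof.
rewrite andbA -mem_words words1_split [in RHS]mem_cat.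
have [wl|wl] /= := boolP (w \in leading_words n).
  by rewrite orbT (leading_words_head wl).
by rewrite orbF; case: mapP => // -[v _ ->]; rewrite andbF.
Qed.

Lemma G_homo : {homo (fun n => G n.+1) : m n / m <= n}.
Proof.
apply: homo_leq => // [? ? ?|n]; first exact: leq_trans.
by rewrite -!(size_words_recursion _ L_gt0 recG) size_wordsS; nia.
Qed.

Lemma value_leading_words n :
  map value (leading_words n) = iota (G n.+1) (G n.+2 - G n.+1).
Proof.
have := value_words n.+1 1.
rewrite (size_words_recursion _ L_gt0 recG) -(subnKC (G_homo (leqnSn n))).
rewrite iotaD {1}words1_split map_cat => /eqP; rewrite eqseq_cat.
  by case/andP => _ /eqP ->; rewrite addKn.
by rewrite !size_map size_iota (size_words_recursion _ L_gt0 recG).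
Qed.

Lemma legal_leading_words a :
  legal L c a <-> a \in leading_words (size a).-1.
Proof.
split=> [/(legal_admissible c1_gt0)[ada hda]|].
  by rewrite mem_leading_words ada hda; case: a {ada} hda => //= x a _; rewrite eqxx.
rewrite mem_leading_words => /and3P[_ ada hda].
exact: (@legal_of_admissible L c 1 a).
Qed.

(** Words of different lengths have values in disjoint intervals and words of
the same length have distinct values, so the legal decomposition chosen by
[digit] can only be w. *)
Lemma digit_value n w : w \in leading_words n ->
  forall j, digit L c G (value w) j = nth 0 w j.
Proof.
move=> wn j; rewrite /digit; congr nth.
have sw : size w = n.+1.
  by move: wn; rewrite mem_leading_words => /andP[/eqP].
apply: xget_subset1 => [|a b [la aE] [lb bE]].
  by split=> //; apply/legal_leading_words; rewrite sw.
have range d : legal L c d -> value w = value d ->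
    G (size d) <= value w < G (size d).+1.
  move=> ld ->; have hd : 0 < head 0 d by case: (legal_admissible c1_gt0 ld).
  have : value d \in map value (leading_words (size d).-1).
    by apply: map_f; apply/legal_leading_words.
  rewrite value_leading_words mem_iota prednK; last by case: d hd {ld}.
  by rewrite subnKC; [|have := G_homo (leqnSn (size d).-1)]; case: (d) hd.
have Ra := range a la aE; have Rb := range b lb bE.
have sab : size a = size b.
  case: (ltngtP (size a) (size b)) => // ab.
    have := @G_homo (size a) (size b).-1; case: (size b) ab Rb => //= m; lia.
  have := @G_homo (size b) (size a).-1; case: (size a) ab Ra => //= m; lia.
have uv : uniq (map value (leading_words (size b).-1)).
  by rewrite value_leading_words iota_uniq.
move/legal_leading_words: la; move/legal_leading_words: lb => lb.
rewrite sab => la.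
apply: (uniq_map_inj uv la lb); exact: etrans (esym aE) bE.
Qed.

End Values.

(** * Limits of sequences *)

Section Limits.
Variable R : realType.
Implicit Types (f g e : nat -> R).

Lemma cvg_dist_le f e (l : R) : (forall n, `|f n - l| <= e n) ->
  e @ \oo --> 0 -> f @ \oo --> l.
Proof.
move=> fe /cvgrPdist_lt e0; apply/cvgrPdist_lt => eps /e0.
apply: filterS => n; rewrite sub0r normrN distrC; apply: le_lt_trans.
exact: le_trans (fe n) (ler_norm _).
Qed.

Lemma cvg_sum_nat (m n : nat) (F : nat -> nat -> R) (l : nat -> R) :
  (forall i, (m <= i < n)%N -> F i @ \oo --> l i) ->
  (fun k => \sum_(m <= i < n) F i k) @ \oo --> \sum_(m <= i < n) l i.
Proof.
move=> Fl; rewrite [X in X @ _](_ : _ =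
    fun k => \sum_(i <- index_iota m n | i \in index_iota m n) F i k).
  rewrite [X in _ --> X]big_seq; apply: cvg_big => [|i].
    exact: add_continuous.
  by rewrite mem_index_iota; apply: Fl.
by apply/funext => k; rewrite [LHS]big_seq.
Qed.

(** The lemma of Cesaro for the increments. *)
Lemma cvg_mean f (l : R) : (fun n => f n.+1 - f n) @ \oo --> l ->
  (fun n => n%:R^-1 * f n) @ \oo --> l.
Proof.
move=> /cesaro dl; rewrite -cvg_shiftS /=.
have f0 : (fun n => n.+1%:R^-1 * f 0%N) @ \oo --> 0.
  by rewrite -(mul0r (f 0%N)); apply: cvgMl; exact: cvg_harmonic.
rewrite -[l]addr0; apply: cvg_trans (cvgD dl f0); apply: near_eq_cvg.
apply: nearW => n.
have sE : series (fun n => f n.+1 - f n) n.+1 = f n.+1 - f 0%N.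
  exact: (telescope_sumr f (leq0n _)).
by rewrite /arithmetic_mean /= fctE /= sE -mulrDr subrK.
Qed.

End Limits.

(** * The transfer operator and its growth *)

Section Vdot.
Variables (R : realType) (L : nat) (v : nat -> R).
Implicit Types f g : nat -> R.

Definition weighted_sum (f : nat -> R) : R := \sum_(1 <= i < L.+1) v i * f i.
Local Notation vdot := weighted_sum.

Lemma vdotZ a f : vdot (fun i => a * f i) = a * vdot f.
Proof. by rewrite /weighted_sum !mulr_sumr; apply: eq_bigr => i _ /=; ring. Qed.

Lemma vdotD f g : vdot (fun i => f i + g i) = vdot f + vdot g.
Proof.
by rewrite /weighted_sum -big_split; apply: eq_bigr => i _ /=; ring.
Qed.

Lemma eq_vdot f g : (forall i, (1 <= i <= L)%N -> f i = g i) -> vdot f = vdot g.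
Proof.
by move=> fg; apply: eq_big_nat => i iL; rewrite fg // -ltnS.
Qed.

Hypothesis v_gt0 : forall i, (1 <= i <= L)%N -> 0 < v i.

Lemma vdot_le f g : (forall i, (1 <= i <= L)%N -> f i <= g i) -> vdot f <= vdot g.
Proof.
move=> fg; apply: ler_sum_nat => i iL; rewrite ler_wpM2l ?fg // ltW //.
by rewrite v_gt0.
Qed.

Lemma vdot_gt0 f : (0 < L)%N ->
  (forall i, (1 <= i <= L)%N -> 0 < f i) -> 0 < vdot f.
Proof.
move=> L_gt0 f0; rewrite /weighted_sum big_ltn // ltr_wpDr ?mulr_gt0 ?f0 ?v_gt0 //.
rewrite big_nat sumr_ge0 // => i iL.
by rewrite mulr_ge0 ?ltW ?f0 ?v_gt0 //; lia.
Qed.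

End Vdot.

Section Transfer.
Variables (R : realType) (L : nat) (c : nat -> nat).

(** If f gives the sums of some quantity over the words of length n by starting
state, this gives the sums over the words of length n + 1 of the quantity of the
remainder times the weight [om] of the first digit.  The weight 1 gives the
companion matrix. *)
Definition transfer_op (om : nat -> nat) (f : nat -> R) (i : nat) : R :=
  (\sum_(0 <= x < c i) om x)%:R * f 1%N +
  (if (i < L)%N then (om (c i))%:R * f i.+1 else 0).

Local Notation transfer := transfer_op.
Local Notation step := (transfer (fun=> 1%N)).

Lemma stepE f i :
  step f i = (c i)%:R * f 1%N + (if (i < L)%N then f i.+1 else 0).
Proof. by rewrite /transfer_op sum_nat_const_nat subn0 muln1 mul1r. Qed.

Lemma transfer_linear om a b f g :
  transfer om (fun i => a * f i + b * g i) =
  (fun i => a * transfer om f i + b * transfer om g i).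
Proof. by apply/funext => i; rewrite /transfer_op; case: ifP => _; ring. Qed.

Lemma iter_step_linear m a b f g :
  iter m step (fun i => a * f i + b * g i) =
  (fun i => a * iter m step f i + b * iter m step g i).
Proof. by elim: m => //= m ->; rewrite transfer_linear. Qed.

Lemma transfer_ge0 om f : (0 < L)%N -> (forall i, (1 <= i <= L)%N -> 0 <= f i) ->
  forall i, (1 <= i <= L)%N -> 0 <= transfer om f i.
Proof.
move=> L_gt0 f0 i iL; rewrite addr_ge0 ?mulr_ge0 ?f0 //; case: ifP => // iL'.
by rewrite mulr_ge0 ?f0.
Qed.

Lemma cvg_transfer om (F : nat -> nat -> R) (l : nat -> R) : (0 < L)%N ->
  (forall i, (1 <= i <= L)%N -> (fun n => F n i) @ \oo --> l i) ->
  forall i, (1 <= i <= L)%N ->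
  (fun n => transfer om (F n) i) @ \oo --> transfer om l i.
Proof.
move=> L_gt0 Fl i iL; apply: cvgD.
  by apply: cvgMr; apply: Fl.
case: ifP => iL'; last exact: cvg_cst.
by apply: cvgMr; apply: Fl.
Qed.

Variables (lam : R) (u v : nat -> R).
Hypotheses (L_gt0 : (0 < L)%N) (c1_gt0 : (0 < c 1)%N) (cL_gt0 : (0 < c L)%N).
Hypothesis lam_gt0 : 0 < lam.
Hypothesis u_gt0 : forall i, (1 <= i <= L)%N -> 0 < u i.
Hypothesis v_gt0 : forall i, (1 <= i <= L)%N -> 0 < v i.
Hypothesis u_right : forall i, (1 <= i <= L)%N -> step u i = lam * u i.

Local Notation vdot := (weighted_sum L v).
Hypothesis v_left : forall f, vdot (step f) = lam * vdot f.

Lemma step_le f g : (forall i, (1 <= i <= L)%N -> f i <= g i) ->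
  forall i, (1 <= i <= L)%N -> step f i <= step g i.
Proof.
move=> fg i iL; rewrite !stepE lerD ?ler_wpM2l ?fg //; case: ifP => // iL'.
exact: fg.
Qed.

Lemma iter_step_le m f g : (forall i, (1 <= i <= L)%N -> f i <= g i) ->
  forall i, (1 <= i <= L)%N -> iter m step f i <= iter m step g i.
Proof. by move=> fg; elim: m => //= m IHm; apply: step_le. Qed.

Lemma iter_step_right m a i : (1 <= i <= L)%N ->
  iter m step (fun i => a * u i) i = a * lam ^+ m * u i.
Proof.
elim: m i => [|m IHm] i iL; first by rewrite mulr1.
rewrite iterS stepE IHm // exprS.
rewrite [if _ then _ else _](_ : _ =
    a * lam ^+ m * (if (i < L)%N then u i.+1 else 0)).
  have := u_right iL; rewrite stepE; nra.
by case: ifP => iL'; rewrite ?mulr0 // IHm.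
Qed.

(** From state i one can move up to state L and from there to state 1, as
0 < c L, and then remain in state 1, as 0 < c 1. *)
Lemma iter_step_ge_first m f i : (forall i, (1 <= i <= L)%N -> 0 <= f i) ->
  (1 <= i <= L)%N -> (i == 1%N) || (L - i < m)%N -> f 1%N <= iter m step f i.
Proof.
move=> f0; elim: m i => [|m IHm] i iL; first by rewrite orbF => /eqP ->.
have fm j : (1 <= j <= L)%N -> 0 <= iter m step f j.
  move=> jL; rewrite -[leLHS](_ : iter m step (fun i => 0 * u i) j = 0).
    by apply: iter_step_le => // k kL; rewrite mul0r f0.
  by rewrite iter_step_right // !mul0r.
move=> iLm; rewrite iterS stepE.
have [iL1|iL1] := boolP ((i == 1%N) || (i == L)).
  have ci : (0 < c i)%N by case/predU1P: iL1 => [->|/eqP ->].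
  apply: le_trans (IHm 1%N _ _) _ => //.
  rewrite ler_wpDr //; first by case: ifP => // iL'; apply: fm.
  by rewrite ler_peMl ?ler1n // fm.
rewrite ifT; last by lia.
by rewrite ler_wpDl ?mulr_ge0 ?fm //; apply: IHm; lia.
Qed.

(** The oscillation of f / u.  With respect to f / u, [step] is lam times
an averaging operator, so it multiplies the oscillation by at most lam. *)
Definition osc_le f D : Prop :=
  exists a, forall i, (1 <= i <= L)%N -> a * u i <= f i <= (a + D) * u i.

Lemma osc_le_exists f : exists D, osc_le f D.
Proof.
pose S := \sum_(1 <= j < L.+1) `|f j| / u j.
exists (S + S); exists (- S) => j jL.
have : `|f j| / u j <= S.
  rewrite /S (bigD1_seq j) ?iota_uniq ?mem_index_iota //=.
  rewrite lerDl big_seq_cond sumr_ge0 // => k /andP[].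
  by rewrite mem_index_iota => kL _; rewrite divr_ge0 // ltW // u_gt0.
by rewrite ler_pdivrMr ?u_gt0 // addKr mulNr -ler_norml.
Qed.

Lemma osc_le_ge0 f D : osc_le f D -> 0 <= D.
Proof.
case=> a /(_ 1%N); rewrite L_gt0 => /(_ isT) /andP[h1 h2].
have u1 : 0 < u 1%N by apply: u_gt0.
by have := le_trans h1 h2; rewrite ler_pM2r // lerDl.
Qed.

Lemma osc_le_mono f D D' : D <= D' -> osc_le f D -> osc_le f D'.
Proof.
move=> DD' [a fa]; exists a => i iL; have := fa i iL => /andP[-> h2].
by rewrite (le_trans h2) // ler_wpM2r ?lerD2l // ltW ?u_gt0.
Qed.

Lemma osc_leD f g D D' : osc_le f D -> osc_le g D' ->
  osc_le (fun i => f i + g i) (D + D').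
Proof.
move=> [a fa] [b gb]; exists (a + b) => i iL.
have /andP[? ?] := fa i iL; have /andP[? ?] := gb i iL; lra.
Qed.

Lemma osc_le_iter m f D : osc_le f D -> osc_le (iter m step f) (lam ^+ m * D).
Proof.
move=> [a fa]; exists (a * lam ^+ m) => i iL.
rewrite -iter_step_right // [lam ^+ m * D]mulrC -mulrDl -iter_step_right //.
by apply/andP; split; apply: iter_step_le => // j /fa /andP[].
Qed.

Lemma osc_le_vdot f D : osc_le f D -> forall i, (1 <= i <= L)%N ->
  `|f i - vdot f / vdot u * u i| <= D * u i.
Proof.
move=> [a fa] i iL; have ui := u_gt0 iL; have pu := vdot_gt0 v_gt0 L_gt0 u_gt0.
set r := vdot f / vdot u.
have r1 : a <= r.
  by rewrite ler_pdivlMr // -vdotZ; apply: (vdot_le v_gt0) => j /fa /andP[].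
have r2 : r <= a + D.
  by rewrite ler_pdivrMr // -vdotZ; apply: (vdot_le v_gt0) => j /fa /andP[].
have /andP[f1 f2] := fa i iL.
rewrite ler_norml; apply/andP; split; nra.
Qed.

Lemma lam_ge1 : 1 <= lam.
Proof.
have u1 : 0 < u 1%N by apply: u_gt0.
rewrite -(ler_pM2r u1) mul1r -u_right // stepE ler_wpDr //.
  by case: ifP => // ?; rewrite ltW // u_gt0.
by rewrite ler_peMl ?ler1n // ltW.
Qed.

(** The contraction of Doeblin.  If a * u <= f <= b * u, then
[iter_step_ge_first] applies to f - a * u and to b * u - f: L steps raise the
lower bound by a fixed share of f 1 / u 1 - a and decrease the upper bound by the
same share of b - f 1 / u 1, in total by that share of b - a. *)
Lemma iter_step_contracts : exists2 ga : R, 0 <= ga < 1 &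
  forall f D, osc_le f D -> osc_le (iter L step f) (lam ^+ L * (ga * D)).
Proof.
have u1 : 0 < u 1%N by apply: u_gt0.
pose S := \sum_(1 <= i < L.+1) u i.
have uS i : (1 <= i <= L)%N -> u i <= S.
  move=> iL; rewrite /S (bigD1_seq i) ?iota_uniq ?mem_index_iota //=.
  rewrite lerDl big_seq_cond sumr_ge0 // => j /andP[].
  by rewrite mem_index_iota => jL _; rewrite ltW // u_gt0.
have S0 : 0 < S by apply: lt_le_trans (uS 1%N _).
have lamL : 1 <= lam ^+ L by rewrite exprn_ege1 // lam_ge1.
(* small enough for lam ^+ L * eta * u i <= u 1 in every state i *)
pose eta := u 1%N / S / lam ^+ L.
have eta0 : 0 < eta by rewrite !divr_gt0 // exprn_gt0.
have eta1 : eta <= 1.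
  rewrite /eta ler_pdivrMr ?exprn_gt0 // mul1r (le_trans _ lamL) //.
  by rewrite ler_pdivrMr // mul1r uS.
exists (1 - eta); first by apply/andP; split; lra.
move=> f D [a fa].
have lower g b : (forall i, (1 <= i <= L)%N -> 0 <= g i) ->
    g 1%N = b * u 1%N -> forall i, (1 <= i <= L)%N ->
    lam ^+ L * (eta * b) * u i <= iter L step g i.
  move=> g0 gb i iL; apply: le_trans (iter_step_ge_first g0 iL _); last by lia.
  have b0 : 0 <= b by rewrite -(pmulr_lge0 _ u1) -gb g0.
  rewrite [lam ^+ L * _](_ : _ = b * u 1%N / S); last first.
    by rewrite /eta; field; rewrite ?expf_neq0 ?lt0r_neq0.
  rewrite gb -mulrA ler_piMr ?mulr_ge0 ?(ltW u1) //.
  by rewrite mulrC ler_pdivrMr // mul1r uS.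
pose al := f 1%N / u 1%N; have f1E : f 1%N = al * u 1%N by rewrite divfK ?gt_eqF.
exists (lam ^+ L * (a + eta * (al - a))) => i iL.
have low := lower (fun i => 1 * f i + (- a) * u i) (al - a) _ _ i iL.
have upp := lower (fun i => (-1) * f i + (a + D) * u i) (a + D - al) _ _ i iL.
rewrite !iter_step_linear in low upp.
have uE : iter L step u i = lam ^+ L * u i.
  have oneu : (fun j => 1 * u j) = u by apply/funext => j; rewrite mul1r.
  by rewrite -[in LHS]oneu iter_step_right // mul1r.
rewrite uE in low upp.
have {}low : lam ^+ L * (eta * (al - a)) * u i <=
    1 * iter L step f i + - a * (lam ^+ L * u i).
  by apply: low => [j /fa /andP[]|]; rewrite ?f1E; [lra|ring].
have {}upp : lam ^+ L * (eta * (a + D - al)) * u i <=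
    -1 * iter L step f i + (a + D) * (lam ^+ L * u i).
  by apply: upp => [j /fa /andP[]|]; rewrite ?f1E; [lra|ring].
apply/andP; split; lra.
Qed.

(** Every step multiplies the pairing with v by lam, and the oscillation,
contracted once in L steps, is negligible against lam ^ n.  Hence the limit is
a multiple of u, identified by its pairing with v. *)
Lemma iter_step_cvg f i : (1 <= i <= L)%N ->
  (fun n => iter n step f i / lam ^+ n) @ \oo --> vdot f / vdot u * u i.
Proof.
move=> iL; have [ga /andP[ga0 ga1] contr] := iter_step_contracts.
have [D fD] := osc_le_exists f.
have blocks q : osc_le (iter (q * L) step f) (lam ^+ (q * L) * (ga ^+ q * D)).
  elim: q => [|q IHq]; first by rewrite !mul1r.
  rewrite mulSn iterD; apply: osc_le_mono (contr _ _ IHq).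
  by rewrite le_eqVlt; apply/orP; left; apply/eqP; rewrite exprD exprS; ring.
have all_n n : osc_le (iter n step f) (lam ^+ n * (ga ^+ (n %/ L) * D)).
  rewrite {1 2}(divn_eq n L) addnC iterD exprD -mulrA.
  exact/osc_le_iter/blocks.
have vdotn n : vdot (iter n step f) = lam ^+ n * vdot f.
  by elim: n => [|n IHn]; rewrite ?mul1r // iterS v_left IHn exprS mulrA.
have pu := vdot_gt0 v_gt0 L_gt0 u_gt0.
apply: (@cvg_dist_le _ _ (fun n => ga ^+ (n %/ L) * (D * u i))) => [n|].
  have lamn : 0 < lam ^+ n by rewrite exprn_gt0.
  have := osc_le_vdot (all_n n) iL; rewrite vdotn => le_osc.
  rewrite (_ : _ - _ = (iter n step f i - lam ^+ n * vdot f / vdot u * u i) / lam ^+ n);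
    last by field; rewrite !lt0r_neq0.
  rewrite normrM normfV [`|lam ^+ n|]gtr0_norm // ler_pdivrMr //.
  by apply: le_trans le_osc _; rewrite le_eqVlt; apply/orP; left; apply/eqP; ring.
rewrite -(mul0r (D * u i)); apply: cvgMl.
apply: (@cvg_comp _ _ _ (fun n => n %/ L)%N (GRing.exp ga) \oo \oo).
  exact: cvg_divnr.
by apply: cvg_expr; rewrite ger0_norm.
Qed.

Section Forced.
Variables T B : nat -> nat -> R.
Hypothesis T_rec : forall n i, T n.+1 i = step (T n) i + B n.+1 i.
Variable be : nat -> R.
Hypothesis B_cvg : forall i, (1 <= i <= L)%N ->
  (fun n => B n i / lam ^+ n) @ \oo --> be i.

Lemma osc_forcing : exists e, forall n, osc_le (B n) (lam ^+ n * e).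
Proof.
have [M BM] : exists M : nat -> R, forall i n, (1 <= i <= L)%N ->
    `|B n i| <= M i * lam ^+ n.
  suff /choice[M MP] : forall i, exists M : R, (1 <= i <= L)%N ->
      forall n, `|B n i| <= M * lam ^+ n.
    by exists M => i n iL; apply: MP.
  move=> i; have [iL|_] := boolP (1 <= i <= L)%N; last by exists 0.
  have /cvg_seq_bounded/pinfty_ex_gt0[M M0 MP] : cvgn (fun n => B n i / lam ^+ n).
    by apply/cvg_ex; exists (be i); apply: B_cvg.
  exists M => _ n; have := MP n I; rewrite /= normrM normfV.
  rewrite [`|lam ^+ n|]gtr0_norm ?exprn_gt0 //.
  by rewrite ler_pdivrMr ?exprn_gt0.
pose S := \sum_(1 <= i < L.+1) `|M i| / u i.
exists (S + S) => n; exists (- (lam ^+ n * S)) => i iL.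
have MS : M i <= S * u i.
  rewrite -ler_pdivrMr ?u_gt0 // /S (bigD1_seq i) ?iota_uniq ?mem_index_iota //=.
  rewrite ler_wpDr ?ler_pM2r ?invr_gt0 ?u_gt0 ?ler_norm //.
  rewrite big_seq_cond sumr_ge0 // => k /andP[].
  by rewrite mem_index_iota => kL _; rewrite divr_ge0 // ltW // u_gt0.
rewrite mulrDr addKr mulNr -ler_norml; apply: le_trans (BM i n iL) _.
by rewrite mulrC -mulrA ler_wpM2l // exprn_ge0 // ltW.
Qed.

(** In L steps the homogeneous part is contracted by [ga] and the forcing adds
at most L * e, so that the bound d + L * e / (1 - ga) reproduces itself. *)
Lemma osc_forced : exists D, forall n, osc_le (T n) (lam ^+ n * D).
Proof.
have [ga /andP[ga0 ga1] contr] := iter_step_contracts.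
have [e Be] := osc_forcing; have [d Td] := osc_le_exists (T 0).
have e0 : 0 <= e by have := osc_le_ge0 (Be 0); rewrite mul1r.
have d0 := osc_le_ge0 Td.
have run n m : osc_le (fun i => T (n + m) i - iter m step (T n) i)
    (lam ^+ (n + m) * (m%:R * e)).
  elim: m => [|m IHm].
    by exists 0 => i iL; rewrite addn0 subrr !mul0r mulr0 addr0 mul0r lexx.
  have -> : (fun i => T (n + m.+1) i - iter m.+1 step (T n) i) =
      (fun i => iter 1 step (fun j => T (n + m) j - iter m step (T n) j) i
                + B (n + m).+1 i).
    apply/funext => i; rewrite addnS T_rec iterS /= !stepE; case: ifP => _; ring.
  apply: osc_le_mono (osc_leD (osc_le_iter 1 IHm) (Be _)).
  rewrite le_eqVlt; apply/orP; left; apply/eqP.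
  by rewrite addnS !exprS expr0 -[in RHS]natr1; ring.
have split n m D : osc_le (iter m step (T n)) (lam ^+ (n + m) * D) ->
    osc_le (T (n + m)) (lam ^+ (n + m) * (D + m%:R * e)).
  move=> hD; rewrite [T _](_ : _ = (fun i => iter m step (T n) i +
      (T (n + m) i - iter m step (T n) i))).
    by rewrite mulrDr; apply: osc_leD.
  by apply/funext => i; ring.
have ga' : 0 < 1 - ga by rewrite subr_gt0.
pose E := L%:R * e / (1 - ga).
have EE : E * (1 - ga) = L%:R * e by rewrite divfK ?gt_eqF.
have Le : L%:R * e <= E.
  by rewrite -EE ler_piMr ?gerBl // /E divr_ge0 ?mulr_ge0 // ltW.
exists (d + E); elim/ltn_ind => n IHn; have [nL|Ln] := ltnP n L.
  have := split 0%N n d (osc_le_iter n Td); rewrite !add0n; apply: osc_le_mono.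
  rewrite ler_wpM2l ?exprn_ge0 ?(ltW lam_gt0) // lerD2l (le_trans _ Le) //.
  by rewrite ler_wpM2r // ler_nat ltnW.
rewrite -(subnK Ln).
have := split (n - L)%N L (ga * (d + E)) _.
move=> {}split; apply: osc_le_mono (split _); last first.
  have nL : (n - L < n)%N by lia.
  apply: osc_le_mono (contr _ _ (IHn _ nL)).
  by rewrite le_eqVlt exprD; apply/orP; left; apply/eqP; ring.
by rewrite ler_wpM2l ?exprn_ge0 ?(ltW lam_gt0) //; nra.
Qed.

(** Paired with v, the recursion becomes a plain sum of the forcing terms. *)
Lemma vdot_forced :
  (fun n => n%:R^-1 * (vdot (T n) / lam ^+ n)) @ \oo --> vdot be.
Proof.
apply: cvg_mean; rewrite [X in X @ _](_ : _ = fun n => vdot (B n.+1) / lam ^+ n.+1).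
  rewrite (cvg_shiftS (fun n => vdot (B n) / lam ^+ n)).
  rewrite [X in X @ _](_ : _ = fun n => \sum_(1 <= i < L.+1) v i * (B n i / lam ^+ n)).
    by apply: cvg_sum_nat => i iL; apply: cvgMr; apply: B_cvg.
  by apply/funext => n; rewrite /weighted_sum mulr_suml; apply: eq_bigr => i _; rewrite mulrA.
apply/funext => n; rewrite (@eq_vdot _ _ _ (T n.+1) (fun i => step (T n) i + B n.+1 i)) //.
by rewrite vdotD v_left exprS; field; rewrite !lt0r_neq0 // exprn_gt0.
Qed.

(** A bounded oscillation vanishes after division by n, so every entry of T
follows the pairing of T with v. *)
Lemma forced_cvg i : (1 <= i <= L)%N ->
  (fun n => n%:R^-1 * (T n i / lam ^+ n)) @ \oo --> vdot be / vdot u * u i.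
Proof.
move=> iL; have [D TD] := osc_forced; have pu := vdot_gt0 v_gt0 L_gt0 u_gt0.
have lim1 : (fun n => n%:R^-1 * (vdot (T n) / lam ^+ n) * (u i / vdot u))
    @ \oo --> vdot be / vdot u * u i.
  rewrite mulrAC -mulrA; apply: cvgMl; exact: vdot_forced.
rewrite -[X in _ --> X]addr0.
rewrite [X in X @ _](_ : _ = fun n => n%:R^-1 * (vdot (T n) / lam ^+ n) * (u i / vdot u)
   + n%:R^-1 * ((T n i - vdot (T n) / vdot u * u i) / lam ^+ n)); last first.
  by apply/funext => n; ring.
apply: cvgD => //; rewrite -cvg_shiftS /=.
apply: (@cvg_dist_le _ _ (fun n => harmonic n * (D * u i))) => [n|].
  rewrite subr0 normrM gtr0_norm ?invr_gt0 ?ltr0n // ler_wpM2l ?invr_ge0 //.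
  rewrite normrM normfV [`|lam ^+ _|]gtr0_norm ?exprn_gt0 //.
  rewrite ler_pdivrMr ?exprn_gt0 // (le_trans (osc_le_vdot (TD n.+1) iL)) //.
  by rewrite le_eqVlt; apply/orP; left; apply/eqP; ring.
rewrite -(mul0r (D * u i)); apply: cvgMl; exact: cvg_harmonic.
Qed.
End Forced.

End Transfer.

(** * Gap counts as additive functionals *)

Section Functionals.
Local Open Scope nat_scope.

(** The contribution of a digit x may depend, through [al], on the digits
after it. *)
Fixpoint total (om : nat -> nat) (al : seq nat -> nat) (w : seq nat) : nat :=
  if w is x :: w' then om x * al w' + total om al w' else 0.

(** The default value 1 of [head] rejects the words that are too short. *)
Fixpoint zero_then_pos (k : nat) (w : seq nat) : bool :=
  if k is k'.+1 then (head 1 w == 0) && zero_then_pos k' (behead w)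
  else 0 < head 0 w.

(** A digit x followed by the word w contributes
[gap_head k x * gap_tail k w] gaps of length k.  For k = 0 the factor [gap_tail]
excludes the last digit. *)
Definition gap_head (k : nat) : nat -> nat :=
  if k is _.+1 then fun x => 0 < x else predn.
Definition gap_tail (k : nat) : seq nat -> nat :=
  if k is k'.+1 then fun w => zero_then_pos k' w else fun w => w != [::].

Lemma iota1 n : iota 1 n = map succn (iota 0 n).
Proof. by rewrite -[1]/(1 + 0) iotaDl. Qed.

Lemma zero_then_posE k w :
  zero_then_pos k w =
  all (fun i => nth 0 w i == 0) (iota 0 k) && (0 < nth 0 w k).
Proof.
elim: k w => [|k IHk] [|x w] //=.
  by rewrite andbF.
by rewrite IHk iota1 all_map /= andbA.
Qed.

Lemma gaps_of_length_total k w :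
  gaps_of_length (size w).-1 (nth 0 w) k = total (gap_head k) (gap_tail k) w.
Proof.
case: k => [|k]; rewrite /gaps_of_length /=.
  elim: w => [|x [|y w] IHw] /=; [by rewrite big_geq|by rewrite big_geq ?muln0|].
  rewrite big_nat_recl //= maxn0 subn1 muln1; congr (_ + _).
  exact: IHw.
case: w => [|x w]; first by rewrite (_ : _ - _ = 0) //=; lia.
rewrite [(size _).-1.+1]/= -[(size w).+1]/(size (x :: w)).
elim: w x => [|y w IHw] x.
  have -> : size [:: x] - k.+1 = 0 by rewrite /=; lia.
  by case: k => [|k]; rewrite /= muln0.
(* in a word of at most k + 1 digits no gap of length k + 1 fits *)
have [|kw] := leqP (size (x :: y :: w)) k.+1.
  move=> wk; move: (wk); rewrite -subn_eq0 => /eqP ->.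
  rewrite [total _ _ _]/= -[_ + total _ _ w]/(total _ _ (y :: w)) -IHw.
  rewrite (_ : size (y :: w) - k.+1 = 0); last by move: wk => /=; lia.
  have /negbTE -> : ~~ zero_then_pos k (y :: w).
    by rewrite zero_then_posE negb_and orbC -leqNgt nth_default.
  by rewrite muln0.
rewrite [total _ _ _]/= -[_ + total _ _ w]/(total _ _ (y :: w)) -IHw.
rewrite [size (x :: _)]/= subSn //= (iota1 (_ - _)) count_map.
congr (_ + _).
by rewrite mulnb zero_then_posE iota1 all_map.
Qed.

Lemma sum_zero_then_pos w :
  \sum_(0 <= k < size w) zero_then_pos k w = has (leq 1) w.
Proof.
elim: w => [|x w IHw]; first by rewrite big_nil.
rewrite big_nat_recl //=; case: x => [|x] /=; first by rewrite add0n; exact: IHw.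
by rewrite big1.
Qed.

Lemma zero_then_pos_big k w : size w <= k -> zero_then_pos k w = false.
Proof. by move=> wk; rewrite zero_then_posE [nth _ _ _]nth_default // andbF. Qed.

Lemma sum_gap_local x w K : size w < K ->
  \sum_(0 <= k < K) gap_head k x * gap_tail k w =
  x.-1 * (w != [::]) + (0 < x) * has (leq 1) w.
Proof.
case: K => // K wK; rewrite big_nat_recl //=; congr (_ + _).
rewrite -sum_zero_then_pos big_distrr /= (big_cat_nat (leq0n _) (wK : size w <= K)) //=.
rewrite [X in _ + X]big_nat [X in _ + X]big1 ?addn0 // => k /andP[wk _].
by rewrite zero_then_pos_big // muln0.
Qed.

(** A positive digit x with a later positive digit contributes x - 1 gaps of
length 0 and one longer gap, hence x gaps.  Only the last positive digit falls
short: by 1, or by its whole value if it ends the word. *)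
Lemma sumn_total w K : size w <= K ->
  sumn w = \sum_(0 <= k < K) total (gap_head k) (gap_tail k) w +
           (if has (leq 1) w then maxn (last 0 w) 1 else 0).
Proof.
elim: w => [|x w IHw] wK; first by rewrite big1.
rewrite /= big_split /= sum_gap_local // (IHw (ltnW wK)).
move: (\sum_(_ <= _ < _) _) => S.
case: w {IHw wK} => [|y w]; first by case: x => [|x] //=; lia.
have [hw|hw] := boolP (has (leq 1) (y :: w)).
  by rewrite orbT /= muln1; case: x => [|x] /=; lia.
have -> : last x (y :: w) = 0.
  apply/eqP; rewrite -leqn0 leqNgt /=; apply: contra hw => lw.
  by apply/hasP; exists (last y w); rewrite ?mem_last.
by rewrite orbF; case: x => [|x] /=; lia.
Qed.

Lemma digit_le_cmax L c n i w x : 0 < i <= L ->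
  w \in words L c n i -> x \in w -> x <= cmax L c.
Proof.
have cle j : 0 < j <= L -> c j <= cmax L c.
  by move=> jL; rewrite /cmax; apply: leq_bigmax_seq => //; rewrite mem_index_iota.
rewrite mem_words => iL /andP[_]; elim: w i iL => //= y w IHw i iL.
rewrite inE => /orP[/andP[yc adw]|/and3P[iL' /eqP yc adw]] /predU1P[->|xw].
- exact: leq_trans (ltnW yc) (cle i iL).
- by apply: (IHw 1) => //; case/andP: iL; lia.
- by rewrite yc cle.
- by apply: (IHw i.+1).
Qed.

Lemma gaps_sumn L c n w : w \in words L c n.+1 1 -> 0 < L ->
  gaps n (nth 0 w) <= sumn w <= gaps n (nth 0 w) + (cmax L c).+1.
Proof.
move=> wn L_gt0; have sw : size w = n.+1.
  by move: wn; rewrite mem_words => /andP[/eqP].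
have <- : \sum_(0 <= k < n.+1) total (gap_head k) (gap_tail k) w = gaps n (nth 0 w).
  by apply: eq_bigr => k _; rewrite -gaps_of_length_total sw.
rewrite (@sumn_total w n.+1) ?sw // leq_addr leq_add2l /=.
case: ifP => // _; rewrite geq_max /= andbT leqW //.
apply: (digit_le_cmax _ wn); rewrite ?L_gt0 //.
by case: w sw {wn} => //= x w _; apply: mem_last.
Qed.

Lemma sumn_as_total w : sumn w = total id (fun=> 1) w.
Proof. by elim: w => //= x w ->; rewrite muln1. Qed.

End Functionals.

(** * Sums over words and means over intervals *)

Section WordSums.
Variables (R : realType) (L : nat) (c : nat -> nat).

Definition word_sum (f : seq nat -> nat) (n i : nat) : R :=
  \sum_(w <- words L c n i) (f w)%:R.

Local Notation transfer := (transfer_op L c).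
Local Notation step := (transfer (fun=> 1%N)).

Lemma big_words_cons (F : seq nat -> R) n i :
  \sum_(w <- words L c n.+1 i) F w =
  \sum_(0 <= x < c i) \sum_(w <- words L c n 1) F (x :: w) +
  (if (i < L)%N then \sum_(w <- words L c n i.+1) F (c i :: w) else 0).
Proof.
rewrite /= big_cat big_allpairs_dep /index_iota subn0; congr (_ + _).
by case: ifP => _; rewrite ?big_map // big_nil.
Qed.

Lemma word_sum_cons om al f n i : (forall x w, f (x :: w) = (om x * al w)%N) ->
  word_sum f n.+1 i = transfer om (word_sum al n) i.
Proof.
move=> fE; rewrite /word_sum big_words_cons /transfer_op natr_sum mulr_suml.
congr (_ + _); first apply: eq_bigr => x _.
  by rewrite mulr_sumr; apply: eq_bigr => w _; rewrite fE natrM.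
case: ifP => // _; rewrite mulr_sumr; apply: eq_bigr => w _.
by rewrite fE natrM.
Qed.

Lemma word_sumD f g n i :
  word_sum (fun w => f w + g w)%N n i = word_sum f n i + word_sum g n i.
Proof. by rewrite -big_split; apply: eq_bigr => w _; rewrite natrD. Qed.

Lemma word_sum_total om al n i :
  word_sum (total om al) n.+1 i =
  step (word_sum (total om al) n) i + transfer om (word_sum al n) i.
Proof.
rewrite -(word_sum_cons (f := fun w => total om al (behead w))); last first.
  by move=> x w; rewrite mul1n.
rewrite -(word_sum_cons (f := fun w => om (head 0 w) * al (behead w))%N) //.
rewrite -word_sumD; rewrite /word_sum big_seq [RHS]big_seq.
apply: eq_bigr => w; rewrite mem_words => /andP[]; case: w => // x w _ _ /=.
by rewrite addnC.
Qed.

Lemma word_sum1 n i : word_sum (fun=> 1%N) n i = iter n step (fun=> 1) i.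
Proof.
elim: n i => [|n IHn] i; first by rewrite /word_sum /= big_seq1.
rewrite (word_sum_cons (om := fun=> 1%N) (al := fun=> 1%N)) //=.
by congr transfer; apply/funext => j; apply: IHn.
Qed.

Variable G : nat -> nat.
Hypotheses (L_gt0 : (0 < L)%N) (c1_gt0 : (0 < c 1)%N) (cL_gt0 : (0 < c L)%N).
Hypothesis recG : positive_linear_recursion L c G.

(** The words of length n + 1 whose first digit is 0 are the words of length n
with a 0 in front, so the sum over those with a positive first digit is a
difference of two sums over all words. *)
Lemma expectationQ_words n (f : (nat -> nat) -> R) (F : seq nat -> R) :
  (forall w, w \in words L c n.+1 1 -> f (nth 0%N w) = F w) ->
  expectationQ G n (fun N => f (digit L c G N)) =
  (\sum_(w <- words L c n.+1 1) F w - \sum_(w <- words L c n 1) F (0%N :: w)) /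
  (word_sum (fun=> 1%N) n.+1 1 - word_sum (fun=> 1%N) n 1).
Proof.
move=> fF; rewrite /expectationQ; congr (_ / _).
  rewrite words1_split // big_cat big_map /= [RHS]addrAC subrr add0r.
  rewrite /index_iota -(value_leading_words L_gt0 c1_gt0 recG) big_map.
  rewrite big_seq [RHS]big_seq; apply: eq_bigr => w wn.
  rewrite -fF; last by rewrite words1_split // mem_cat wn orbT.
  by congr f; apply/funext => j; apply: (digit_value L_gt0 c1_gt0 recG wn).
have sizeE m : word_sum (fun=> 1%N) m 1 = (G m.+1)%:R.
  by rewrite -(size_words_recursion _ L_gt0 recG) /word_sum -sum1_size natr_sum.
rewrite !sizeE natrB //.
exact: (G_homo L_gt0 c1_gt0 recG (leqnSn n)).
Qed.

Variables (lam : R) (u v : nat -> R).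
Hypothesis lam_gt1 : 1 < lam.
Hypothesis u_gt0 : forall i, (1 <= i <= L)%N -> 0 < u i.
Hypothesis v_gt0 : forall i, (1 <= i <= L)%N -> 0 < v i.
Hypothesis u_right : forall i, (1 <= i <= L)%N -> step u i = lam * u i.
Local Notation vdot := (weighted_sum L v).
Hypothesis v_left : forall f, vdot (step f) = lam * vdot f.

(** The number of words of length n readable from state i is asymptotic to
kappa * u i * lam ^ n. *)
Definition kappa : R := vdot (fun=> 1) / vdot u.

Let lam_gt0 : 0 < lam. Proof. by apply: lt_trans lam_gt1. Qed.

Lemma kappa_gt0 : 0 < kappa.
Proof. by rewrite divr_gt0 // (vdot_gt0 v_gt0 L_gt0). Qed.

Lemma word_sum1_cvg i : (1 <= i <= L)%N ->
  (fun n => word_sum (fun=> 1%N) n i / lam ^+ n) @ \oo --> kappa * u i.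
Proof.
move=> iL; rewrite [X in X @ _](_ : _ =
    fun n => iter n step (fun=> 1) i / lam ^+ n).
  exact: iter_step_cvg.
by apply/funext => n; rewrite word_sum1.
Qed.

(** The factor [kappa] makes a / u the asymptotic mean of [al] over the words
readable from a given state. *)
Definition growth (al : seq nat -> nat) (a : nat -> R) : Prop :=
  forall i, (1 <= i <= L)%N ->
  (fun n => word_sum al n i / lam ^+ n) @ \oo --> kappa * a i.

Lemma growth_transfer al a om i : growth al a -> (1 <= i <= L)%N ->
  (fun n => transfer om (word_sum al n) i / lam ^+ n.+1) @ \oo -->
  kappa * (lam^-1 * transfer om a i).
Proof.
move=> ga iL.
have -> : kappa * (lam^-1 * transfer om a i) =
    transfer om (fun j => kappa * a j) i / lam.
  have -> : (fun j => kappa * a j) = (fun j => kappa * a j + 0 * a j).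
    by apply/funext => j; rewrite mul0r addr0.
  by rewrite transfer_linear; field; rewrite gt_eqF.
rewrite [X in X @ _](_ : _ =
    fun n => transfer om (fun j => word_sum al n j / lam ^+ n) i / lam).
  by apply: cvgMl; apply: cvg_transfer.
apply/funext => n.
have -> : (fun j => word_sum al n j / lam ^+ n) =
    (fun j => (lam ^+ n)^-1 * word_sum al n j + 0 * word_sum al n j).
  by apply/funext => j; rewrite mul0r addr0 mulrC.
rewrite transfer_linear exprS; field.
by rewrite expf_neq0 gt_eqF.
Qed.

Lemma growth_cons al a f om : growth al a ->
  (forall x w, f (x :: w) = (om x * al w)%N) ->
  growth f (fun i => lam^-1 * transfer om a i).
Proof.
move=> ga fE i iL; rewrite -cvg_shiftS /=.
rewrite [X in X @ _](_ : _ =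
    fun n => transfer om (word_sum al n) i / lam ^+ n.+1).
  exact: growth_transfer.
by apply/funext => n; rewrite (word_sum_cons _ _ fE).
Qed.

Lemma cvg_invn : (fun n => n%:R^-1 : R) @ \oo --> 0.
Proof. by rewrite -cvg_shiftS /=; apply: cvg_harmonic. Qed.

(** As om 0 = 0, a leading 0 contributes nothing, and the sum over the words
with a positive first digit is a difference of two consecutive terms of a
sequence that grows like n * lam ^ n, by [forced_cvg].  The number of these words
grows like lam ^ n with the same dependence on lam and u 1, which cancels. *)
Lemma mean_total_cvg om al a (f : (nat -> nat) -> nat -> nat) :
  om 0%N = 0%N -> growth al a ->
  (forall n w, size w = n.+1 -> f (nth 0%N w) n = total om al w) ->
  (fun n => n%:R^-1 * expectationQ G n (fun N => (f (digit L c G N) n)%:R))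
    @ \oo --> vdot (transfer om a) / lam / vdot u.
Proof.
move=> om0 ga fE.
pose T := word_sum (total om al).
pose B n := if n is m.+1 then transfer om (word_sum al m) else fun=> 0.
have T_rec n i : T n.+1 i = step (T n) i + B n.+1 i by apply: word_sum_total.
pose be i := kappa * (lam^-1 * transfer om a i).
have B_cvg i : (1 <= i <= L)%N -> (fun n => B n i / lam ^+ n) @ \oo --> be i.
  by move=> iL; rewrite -cvg_shiftS /=; apply: growth_transfer.
pose sg := vdot be / vdot u.
have T_cvg i : (1 <= i <= L)%N ->
    (fun n => n%:R^-1 * (T n i / lam ^+ n)) @ \oo --> sg * u i.
  by apply: (forced_cvg _ _ _ _ _ _ _ _ T_rec B_cvg).
have L1 : (1 <= 1 <= L)%N by rewrite L_gt0.
(* unfolding T n.+1 once keeps the factor 1 / n of [T_cvg] *)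
have T1_cvg : (fun n => n%:R^-1 * (T n.+1 1%N / lam ^+ n)) @ \oo --> lam * (sg * u 1%N).
  have -> : lam * (sg * u 1%N) =
      transfer (fun=> 1%N) (fun i => sg * u i) 1%N + 0 * (lam * be 1%N).
    have -> : (fun j => sg * u j) = (fun j => sg * u j + 0 * u j).
      by apply/funext => j; rewrite mul0r addr0.
    by rewrite transfer_linear u_right //; ring.
  rewrite [X in X @ _](_ : _ = fun n => step (fun i => n%:R^-1 * (T n i / lam ^+ n)) 1%N
       + n%:R^-1 * (lam * (B n.+1 1%N / lam ^+ n.+1))).
    apply: cvgD; first exact: cvg_transfer.
    apply: cvgM; first exact: cvg_invn.
    by apply: cvgMr; rewrite (cvg_shiftS (fun n => B n 1%N / lam ^+ n)); apply: B_cvg.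
  apply/funext => n; rewrite T_rec !stepE; case: ifP => _;
   rewrite exprS; move: (n%:R^-1) => r; field; by rewrite expf_neq0 gt_eqF.
pose W n := word_sum (fun=> 1%N) n 1%N.
have W_cvg : (fun n => W n / lam ^+ n) @ \oo --> kappa * u 1%N.
  exact: word_sum1_cvg.
have W1_cvg : (fun n => W n.+1 / lam ^+ n) @ \oo --> lam * (kappa * u 1%N).
  rewrite [X in X @ _](_ : _ = fun n => lam * (W n.+1 / lam ^+ n.+1)).
    by apply: cvgMr; rewrite (cvg_shiftS (fun n => W n / lam ^+ n)).
  by apply/funext => n; rewrite exprS; field; rewrite expf_neq0 gt_eqF.
have u1 := u_gt0 L1; have k0 := kappa_gt0; have pu := vdot_gt0 v_gt0 L_gt0 u_gt0.
have den0 : lam * (kappa * u 1%N) - kappa * u 1%N != 0.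
  rewrite (_ : _ - _ = (lam - 1) * (kappa * u 1%N)); last by ring.
  by apply: lt0r_neq0; apply: mulr_gt0 (mulr_gt0 k0 u1); rewrite subr_gt0.
have lim := cvgM (cvgB T1_cvg (T_cvg _ L1)) (cvgV den0 (cvgB W1_cvg W_cvg)).
have -> : vdot (transfer om a) / lam / vdot u =
    (lam * (sg * u 1%N) - sg * u 1%N) /
    (lam * (kappa * u 1%N) - kappa * u 1%N).
  rewrite /sg /be !vdotZ; field.
  by rewrite ?den0 !gt_eqF.
rewrite [X in X @ _](_ : _ = fun n =>
    (n%:R^-1 * (T n.+1 1%N / lam ^+ n) - n%:R^-1 * (T n 1%N / lam ^+ n)) *
    (W n.+1 / lam ^+ n - W n / lam ^+ n)^-1).
  exact: lim.
apply/funext => n.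
rewrite (@expectationQ_words n (fun X => (f X n)%:R) (fun w => (total om al w)%:R)).
  have -> : \sum_(w <- words L c n 1) (total om al (0%N :: w))%:R = T n 1%N.
    by rewrite /= om0.
  rewrite -/(T n.+1 1%N) -/(W n) -/(W n.+1) -mulrBr -!mulrBl.
  have p0 : lam ^+ n != 0 by rewrite expf_neq0 // gt_eqF.
  by rewrite invfM invrK mulrA mulrACA mulVf // mulr1 mulrA.
by move=> w; rewrite mem_words => /andP[/eqP sw _]; rewrite fE.
Qed.

End WordSums.

(** * Runs of zero coefficients and gap densities *)

Definition pos_digit (x : nat) : nat := (0 < x)%N.
Definition zero_digit (x : nat) : nat := (x == 0%N).

Section Runs.
Variables (L : nat) (c : nat -> nat).
Hypothesis cL_gt0 : (0 < c L)%N.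

Lemma zero_runP b : (b < L)%N ->
  [/\ (b + zero_run L c b < L)%N, (0 < c (b + zero_run L c b).+1)%N
    & forall i, (0 < i <= zero_run L c b)%N -> c (b + i)%N = 0%N].
Proof.
(* the run ends before L because 0 < c L *)
move=> bL; have ex : exists r, (b + r < L)%N && (0 < c (b + r).+1)%N.
  by exists (L - b.+1)%N; rewrite (_ : (b + _).+1 = L) ?cL_gt0; lia.
have [r /andP[rL cr] rmin] := ex_minnP ex.
have zeros i : (0 < i <= r)%N -> c (b + i)%N = 0%N.
  case: i => // i ir; apply/eqP; rewrite -leqn0 leqNgt addnS; apply/negP => ci.
  have := rmin i; rewrite ci andbT (_ : b + i < L)%N; last by lia.
  by move=> /(_ isT); lia.
suff -> : zero_run L c b = r by split.
apply/eqP; rewrite eqn_leq /zero_run; apply/andP; split.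
  apply/bigmax_leqP_seq => j; rewrite mem_index_iota => jL /andP[bj /allP cj].
  rewrite leqNgt; apply/negP => rj.
  have := cj r.+1; rewrite mem_iota addnS => /(_ _)/eqP cr0.
  by move: cr; rewrite cr0 //; lia.
have [->//|r0] := posnP r.
apply: (@leq_bigmax_seq _ _ _ id r); first by rewrite mem_index_iota; lia.
rewrite ltnW //=; apply/allP => i; rewrite mem_iota => ir.
by rewrite zeros //; lia.
Qed.

Lemma zero_run_eq0 b : (b < L)%N -> (0 < c b.+1)%N -> zero_run L c b = 0%N.
Proof.
move=> bL cb; have [_ _ zs] := zero_runP bL.
case: (posnP (zero_run L c b)) => // r0; move: cb; rewrite -[b.+1]addn1 zs //; lia.
Qed.

Lemma zero_runS b : (b < L)%N -> c b.+1 = 0%N ->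
  [/\ (b.+1 < L)%N & zero_run L c b = (zero_run L c b.+1).+1].
Proof.
move=> bL cb; have b1L : (b.+1 < L)%N.
  by rewrite ltn_neqAle bL andbT; apply: contra_eqN cb => /eqP ->; rewrite -lt0n.
split=> //; have [rL cr zs] := zero_runP bL; have [rL' cr' zs'] := zero_runP b1L.
move: (zero_run L c b) (zero_run L c b.+1) rL cr zs rL' cr' zs' => r r' rL cr zs rL' cr' zs'.
have r0 : (0 < r)%N by case: r cr {rL zs} => //; rewrite addn0 cb.
case: (ltngtP r r'.+1) => // rr'.
  by move: cr; rewrite -addSn zs' //; lia.
by move: cr'; rewrite addSn -!addnS zs //; lia.
Qed.

End Runs.

Section Algebra.
Variables (R : realType) (L : nat) (c : nat -> nat).
Local Notation transfer := (transfer_op L c).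
Local Notation step := (transfer (fun=> 1%N)).
Variables (lam : R) (u v : nat -> R).
Hypotheses (L_gt0 : (0 < L)%N) (c1_gt0 : (0 < c 1)%N) (cL_gt0 : (0 < c L)%N).
Hypothesis lam_gt0 : 0 < lam.
Hypothesis u_gt0 : forall i, (1 <= i <= L)%N -> 0 < u i.
Hypothesis u_right : forall i, (1 <= i <= L)%N -> step u i = lam * u i.
Local Notation vdot := (weighted_sum L v).
Hypothesis v_left : forall f, vdot (step f) = lam * vdot f.

Implicit Types f g : nat -> R.

Let lamN0 : lam != 0. Proof. by rewrite gt_eqF. Qed.

Lemma transfer_pos_digit f i : transfer pos_digit f i = step f i - transfer zero_digit f i.
Proof.
have split x : (pos_digit x)%:R = 1 - (zero_digit x)%:R :> R.
  by case: x => [|x]; rewrite ?subrr ?subr0.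
rewrite /transfer_op !natr_sum (eq_bigr _ (fun x _ => split x)) sumrB.
by case: ifP => _; rewrite ?split; ring.
Qed.

Lemma vdot_transfer_pos_digitB g :
  vdot (transfer pos_digit g) = lam * vdot g - vdot (transfer zero_digit g).
Proof.
rewrite -v_left /weighted_sum -sumrB; apply: eq_bigr => i _.
by rewrite transfer_pos_digit mulrBr.
Qed.

Lemma transfer_predn f i :
  transfer predn f i = transfer id f i - transfer pos_digit f i.
Proof.
have split x : x.-1%:R = x%:R - (pos_digit x)%:R :> R.
  by case: x => [|x]; rewrite ?subr0 // -natr1 addrK.
rewrite /transfer_op !natr_sum (eq_bigr _ (fun x _ => split x)) sumrB.
by case: ifP => _; rewrite ?split; ring.
Qed.

Lemma vdot_transfer_predn g :
  vdot (transfer predn g) = vdot (transfer id g) - vdot (transfer pos_digit g).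
Proof.
rewrite /weighted_sum -sumrB; apply: eq_bigr => i _.
by rewrite transfer_predn mulrBr.
Qed.

Lemma transfer_zero_digit_pos f i : (0 < c i)%N -> transfer zero_digit f i = f 1%N.
Proof.
move=> ci; rewrite /transfer_op /zero_digit (gtn_eqF ci) mul0r if_same addr0.
by rewrite big_ltn // big_nat big1 ?mul1r // => x /andP[x0 _]; rewrite gtn_eqF.
Qed.

Lemma transfer_zero_digit_zero f i : (i < L)%N -> c i = 0%N -> transfer zero_digit f i = f i.+1.
Proof. by move=> iL ci; rewrite /transfer_op ci big_geq // iL mul0r mul1r add0r. Qed.

Lemma zero_ltL i : (1 <= i <= L)%N -> c i = 0%N -> (1 < i < L)%N.
Proof.
move=> iL ci.
have i1 : i != 1%N by apply: contra_eqN ci => /eqP ->; rewrite -lt0n.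
have iLN : i != L by apply: contra_eqN ci => /eqP ->; rewrite -lt0n.
lia.
Qed.

Lemma right_eigen_zero i : (1 <= i <= L)%N -> c i = 0%N -> u i.+1 = lam * u i.
Proof.
move=> iL ci; have /andP[_ iL'] := zero_ltL iL ci.
by rewrite -u_right // stepE ci iL' mul0r add0r.
Qed.

(** Only state i leads to state i + 1. *)
Lemma left_eigen_succ i : (1 <= i < L)%N -> v i = lam * v i.+1.
Proof.
move=> iL; have := v_left (fun j => (j == i.+1)%:R).
have one f j : (1 <= j <= L)%N -> vdot (fun k => (k == j)%:R * f k) = v j * f j.
  move=> jL; rewrite /weighted_sum (bigD1_seq j) ?iota_uniq ?mem_index_iota //=.
  rewrite eqxx mul1r big1 ?addr0 // => k /negbTE ->; rewrite mul0r mulr0 //.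
rewrite (@eq_vdot _ _ _ (step _) (fun k => (k == i)%:R * 1)).
  rewrite (@eq_vdot _ _ _ (fun k => (k == i.+1)%:R) (fun k => (k == i.+1)%:R * 1)).
    by rewrite !one ?mulr1 //; lia.
  by move=> k _; rewrite mulr1.
move=> k kL; rewrite stepE (_ : (1 == i.+1)%N = false); last by lia.
by rewrite mulr0 add0r eqSS mulr1; case: ifP => // kL'; rewrite (_ : k == i = false) //; lia.
Qed.

(** Inside a run of zero coefficients lam * v j = v (j - 1), so the terms
lam * v j * g j and v (j - 1) * g j cancel and only the two ends of each run
remain. *)
Lemma zero_runs_flow g :
  \sum_(1 <= i < L.+1 | c i == 0%N) v i * (lam * g i - g i.+1) =
  \sum_(1 <= i < L | (0 < c i)%N && (c i.+1 == 0%N)) v i * g i.+1 -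
  \sum_(1 <= i < L | (c i == 0%N) && (0 < c i.+1)%N) v i * g i.+1.
Proof.
have -> : \sum_(1 <= i < L.+1 | c i == 0%N) v i * (lam * g i - g i.+1) =
    \sum_(1 <= i < L.+1 | c i == 0%N) lam * v i * g i -
    \sum_(1 <= i < L.+1 | c i == 0%N) v i * g i.+1.
  by rewrite -sumrB; apply: eq_bigr => i _; ring.
have -> : \sum_(1 <= i < L.+1 | c i == 0%N) lam * v i * g i =
    \sum_(1 <= i < L | c i.+1 == 0%N) v i * g i.+1.
  rewrite big_mkcond big_ltn // (gtn_eqF c1_gt0) /= add0r big_add1 /=.
  rewrite [RHS]big_mkcond; apply: eq_big_nat => i iL.
  by rewrite (left_eigen_succ iL).
have -> : \sum_(1 <= i < L.+1 | c i == 0%N) v i * g i.+1 =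
    \sum_(1 <= i < L | c i == 0%N) v i * g i.+1.
  by rewrite !(big_mkcond (fun i => c i == 0%N)) big_nat_recr //= (gtn_eqF cL_gt0) /= addr0.
rewrite [X in X - _ = _]big_mkcond [X in _ - X = _]big_mkcond.
rewrite [X in _ = X - _]big_mkcond [X in _ = _ - X]big_mkcond -!sumrB.
apply: eq_bigr => i _.
by case: (c i) => [|?]; case: (c i.+1) => [|?] /=; ring.
Qed.

(** One factor 1 / lam for each zero that has to be read before a state with
a positive coefficient is reached. *)
Definition run_weight i : R := lam ^- (zero_run L c i.-1).

Lemma run_weight_pos i : (1 <= i <= L)%N -> (0 < c i)%N -> run_weight i = 1.
Proof.
case: i => // i iL ci; by rewrite /run_weight zero_run_eq0 // expr0 invr1.
Qed.

Lemma run_weight_zero i : (1 <= i <= L)%N -> c i = 0%N ->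
  lam * run_weight i = run_weight i.+1.
Proof.
case: i => // i iL ci; have [_ rE] := zero_runS cL_gt0 iL ci.
by rewrite /run_weight /= rE exprS invfM mulVKf.
Qed.

(** For g = [run_weight] the left-hand side of [zero_runs_flow] vanishes. *)
Lemma sum_run_starts :
  \sum_(1 <= i < L | (0 < c i)%N && (c i.+1 == 0%N)) v i * run_weight i.+1 =
  \sum_(1 <= i < L | (c i == 0%N) && (0 < c i.+1)%N) v i.
Proof.
apply/eqP; rewrite -subr_eq0; apply/eqP.
rewrite [X in _ - X](_ : _ =
   \sum_(1 <= i < L | (c i == 0%N) && (0 < c i.+1)%N) v i * run_weight i.+1).
  rewrite -zero_runs_flow big_nat_cond big1 // => i /andP[iL /eqP ci].
  by rewrite run_weight_zero // subrr mulr0.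
rewrite big_nat_cond [RHS]big_nat_cond; apply: eq_bigr => i /andP[iL /andP[_ ci]].
by rewrite run_weight_pos ?mulr1 //; case/andP: iL.
Qed.

(** Asymptotically kappa * gap_density k i * lam ^ n of the words of length n
readable from state i begin with exactly k zeros followed by a positive digit. *)
Fixpoint gap_density (k : nat) : nat -> R :=
  if k is k'.+1 then fun i => lam^-1 * transfer zero_digit (gap_density k') i
  else fun i => lam^-1 * transfer pos_digit u i.

Lemma gap_density0_zero i : (1 <= i <= L)%N -> c i = 0%N -> gap_density 0 i = 0.
Proof.
move=> iL ci; have /andP[_ iL'] := zero_ltL iL ci.
by rewrite /= transfer_pos_digit u_right // transfer_zero_digit_zero // right_eigen_zero // subrr mulr0.
Qed.

Lemma gap_density0_pos i : (1 <= i <= L)%N -> (0 < c i)%N ->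
  gap_density 0 i = u i - u 1%N / lam.
Proof.
move=> iL ci; rewrite /= transfer_pos_digit u_right // transfer_zero_digit_pos //.
by field.
Qed.

(** The first zero leads to state 1, where each further zero costs a factor
1 / lam. *)
Lemma gap_densityS_pos k i : (0 < c i)%N ->
  gap_density k.+1 i = lam ^- k.+1 * ((1 - lam^-1) * u 1%N).
Proof.
have recE j m : gap_density j.+1 m = lam^-1 * transfer zero_digit (gap_density j) m by [].
elim: k i => [|k IHk] i ci; rewrite recE transfer_zero_digit_pos //.
  by rewrite gap_density0_pos //; field.
by rewrite IHk // [in RHS]exprS invfM mulrA.
Qed.

Lemma gap_densityS_zero k i : (1 <= i <= L)%N -> c i = 0%N ->
  gap_density k.+1 i = lam^-1 * gap_density k i.+1.
Proof.
by move=> iL ci; have /andP[_ iL'] := zero_ltL iL ci; rewrite /= transfer_zero_digit_zero.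
Qed.

Lemma right_run b : (b < L)%N ->
  u b.+1 = lam ^- (zero_run L c b) * u (b + zero_run L c b).+1.
Proof.
move=> bL; have [rL _ zs] := zero_runP cL_gt0 bL.
elim: (zero_run L c b) rL zs => [|r IHr] rL zs; first by rewrite addn0 invr1 mul1r.
rewrite IHr; [|by lia|by move=> i ir; apply: zs; lia].
have ur : u (b + r).+2 = lam * u (b + r).+1.
  by rewrite right_eigen_zero //; [lia|rewrite -addnS zs //; lia].
rewrite addnS ur.
by rewrite exprS; field; rewrite expf_neq0.
Qed.

Lemma gap_density_run b k : (b < L)%N ->
  gap_density k b.+1 =
  if (k < zero_run L c b)%N then 0 else
  lam ^- (zero_run L c b) *
  gap_density (k - zero_run L c b) (b + zero_run L c b).+1.
Proof.
move=> bL; have [rL _ zs] := zero_runP cL_gt0 bL.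
move: (zero_run L c b) rL zs => r; elim: r b k bL => [|r IHr] b k bL rL zs.
  by rewrite subn0 addn0 invr1 mul1r.
have cb : c b.+1 = 0%N by rewrite -[b.+1]addn1 zs.
case: k => [|k]; first by rewrite gap_density0_zero.
rewrite gap_densityS_zero // ltnS subSS (IHr b.+1 k).
- by rewrite addSnnS; case: ifP => _; rewrite ?mulr0 // exprS invfM mulrA.
- by lia.
- by lia.
- by move=> i ir; rewrite addSnnS zs //; lia.
Qed.

(** The probability, in the stationary chain, that the digit read at the end
of the run of zero coefficients after b is 0. *)
Definition run_exit b : R := u 1%N / (lam * u (b + zero_run L c b).+1).

Lemma run_exitE b : (b < L)%N ->
  u b.+1 * run_exit b = u 1%N / lam * run_weight b.+1.
Proof.
move=> bL; rewrite /run_weight /= right_run // /run_exit; field.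
rewrite lamN0 expf_neq0 //= gt_eqF // u_gt0 //.
by have [rL _ _] := zero_runP cL_gt0 bL.
Qed.

(** Up to the end of the run zeros are forced.  There the next digit is
positive with probability 1 - [run_exit b], and otherwise the gap continues in
state 1. *)
Lemma gap_density_start b k : (b < L)%N ->
  gap_density k b.+1 = u b.+1 *
  (if (k < zero_run L c b)%N then 0
   else if k == zero_run L c b then 1 - run_exit b
   else run_exit b * lam ^- (k - zero_run L c b).-1 * (1 - lam^-1)).
Proof.
move=> bL; have [rL cr zs] := zero_runP cL_gt0 bL.
rewrite gap_density_run //; case: ltngtP => [||->]; first by rewrite mulr0.
  move=> rk; have [m mE] : exists m, (k - zero_run L c b = m.+1)%N.
    by exists (k - zero_run L c b).-1; lia.
  rewrite mE gap_densityS_pos // [RHS]mulrA [u b.+1 * _]mulrA run_exitE //.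
  by rewrite /run_weight /= exprS; field; rewrite lamN0 !expf_neq0.
rewrite subnn gap_density0_pos // [in RHS]mulrBr mulr1 run_exitE // (right_run bL).
by rewrite /run_weight /=; field; rewrite lamN0 !expf_neq0.
Qed.

(** The weight of the positive digits is that of all digits less that of the
digit 0, which leads from i to state 1 if c i > 0 and to i + 1 if c i = 0. *)
Lemma vdot_transfer_pos_digit g :
  vdot (transfer pos_digit g) =
  \sum_(1 <= i < L.+1 | (0 < c i)%N) v i * (lam * g i - g 1%N) +
  \sum_(1 <= i < L.+1 | c i == 0%N) v i * (lam * g i - g i.+1).
Proof.
have -> : vdot (transfer pos_digit g) =
    \sum_(1 <= i < L.+1) v i * (lam * g i - transfer zero_digit g i).
  by rewrite vdot_transfer_pos_digitB /weighted_sum mulr_sumr -sumrB; apply: eq_bigr => i _; ring.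
rewrite [X in X + _]big_mkcond [X in _ + X]big_mkcond -big_split.
apply: eq_big_nat => i iL /=.
have [ci|ci] := posnP (c i).
  by rewrite add0r transfer_zero_digit_zero //; case/andP: (zero_ltL iL ci).
by rewrite addr0 transfer_zero_digit_pos.
Qed.

Let V : R := \sum_(1 <= i < L.+1 | (0 < c i)%N) v i.

(** On the states with a positive coefficient the density is constant.  By
[zero_runs_flow] the other states contribute through the starts and ends of the
runs, and [sum_run_starts] turns the ends, where the density takes the same
constant value, into starts. *)
Lemma vdot_gap_densityS k :
  vdot (transfer pos_digit (gap_density k.+1)) =
  (1 - lam^-1) * (V * u 1%N) * (lam ^- k * (1 - lam^-1)) +
  \sum_(1 <= i < L | (0 < c i)%N && (c i.+1 == 0%N))
    v i * (gap_density k.+1 i.+1 - u i.+1 * run_exit i * (lam ^- k * (1 - lam^-1))).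
Proof.
rewrite vdot_transfer_pos_digit zero_runs_flow.
set ga := lam ^- k.+1 * ((1 - lam^-1) * u 1%N).
have -> : \sum_(1 <= i < L.+1 | (0 < c i)%N)
     v i * (lam * gap_density k.+1 i - gap_density k.+1 1%N) = V * ((lam - 1) * ga).
  rewrite /V mulr_suml; apply: eq_bigr => i ci.
  by rewrite !gap_densityS_pos // -/ga; ring.
have -> : \sum_(1 <= i < L | (c i == 0%N) && (0 < c i.+1)%N) v i * gap_density k.+1 i.+1 =
    \sum_(1 <= i < L | (0 < c i)%N && (c i.+1 == 0%N)) v i * run_weight i.+1 * ga.
  rewrite -mulr_suml sum_run_starts mulr_suml; apply: eq_bigr => i /andP[_ ci].
  by rewrite gap_densityS_pos.
rewrite -sumrB; congr (_ + _).
  by rewrite /ga exprS; field; rewrite lamN0 expf_neq0.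
rewrite big_nat_cond [RHS]big_nat_cond; apply: eq_bigr => i /andP[/andP[_ iL] _].
by rewrite run_exitE // /ga exprS; field; rewrite lamN0 expf_neq0.
Qed.

(** As in [vdot_gap_densityS], but the density vanishes at the starts of the
runs and is not constant at their ends; the part of it that varies is u, for
which [zero_runs_flow] again exchanges ends and starts. *)
Lemma vdot_gap_density0 :
  vdot (transfer pos_digit (gap_density 0)) =
  vdot (transfer pos_digit u) - V * u 1%N * (1 - lam^-1) -
  \sum_(1 <= i < L | (0 < c i)%N && (c i.+1 == 0%N))
    v i * (u i.+1 * (1 - run_exit i)).
Proof.
rewrite !vdot_transfer_pos_digit !zero_runs_flow.
have -> : \sum_(1 <= i < L | (0 < c i)%N && (c i.+1 == 0%N)) v i * gap_density 0 i.+1 = 0.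
  rewrite big_nat_cond big1 // => i /andP[iL /andP[_ /eqP ci]].
  by rewrite gap_density0_zero ?mulr0 //; case/andP: iL.
have -> : \sum_(1 <= i < L | (c i == 0%N) && (0 < c i.+1)%N) v i * gap_density 0 i.+1 =
    \sum_(1 <= i < L | (c i == 0%N) && (0 < c i.+1)%N) v i * u i.+1 -
    u 1%N / lam * \sum_(1 <= i < L | (0 < c i)%N && (c i.+1 == 0%N)) v i * run_weight i.+1.
  rewrite sum_run_starts mulr_sumr -sumrB big_nat_cond [RHS]big_nat_cond.
  apply: eq_bigr => i /andP[iL /andP[_ ci]].
  by rewrite gap_density0_pos //; [ring|case/andP: iL].
have -> : \sum_(1 <= i < L | (0 < c i)%N && (c i.+1 == 0%N)) v i * (u i.+1 * (1 - run_exit i)) =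
   \sum_(1 <= i < L | (0 < c i)%N && (c i.+1 == 0%N)) v i * u i.+1 -
   u 1%N / lam * \sum_(1 <= i < L | (0 < c i)%N && (c i.+1 == 0%N)) v i * run_weight i.+1.
  rewrite mulr_sumr -sumrB big_nat_cond [RHS]big_nat_cond.
  apply: eq_bigr => i /andP[/andP[_ iL] _].
  by rewrite mulrBr mulr1 run_exitE //; ring.
have -> : \sum_(1 <= i < L.+1 | (0 < c i)%N) v i * (lam * gap_density 0 i - gap_density 0 1%N) =
  \sum_(1 <= i < L.+1 | (0 < c i)%N) v i * (lam * u i - u 1%N) - V * u 1%N * (1 - lam^-1).
  rewrite /V !mulr_suml -sumrB big_nat_cond [RHS]big_nat_cond.
  apply: eq_bigr => i /andP[iL ci].
  by rewrite !gap_density0_pos //; field.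
ring.
Qed.

End Algebra.

(** * Limits of the mean gap counts *)

Section GapLimits.
Variables (R : realType) (L : nat) (c G : nat -> nat).
Local Notation transfer := (transfer_op L c).
Local Notation step := (transfer (fun=> 1%N)).
Variables (lam : R) (u v : nat -> R).
Hypotheses (L_gt0 : (0 < L)%N) (c1_gt0 : (0 < c 1)%N) (cL_gt0 : (0 < c L)%N).
Hypothesis recG : positive_linear_recursion L c G.
Hypothesis lam_gt1 : 1 < lam.
Hypothesis u_gt0 : forall i, (1 <= i <= L)%N -> 0 < u i.
Hypothesis v_gt0 : forall i, (1 <= i <= L)%N -> 0 < v i.
Hypothesis u_right : forall i, (1 <= i <= L)%N -> step u i = lam * u i.
Local Notation vdot := (weighted_sum L v).
Hypothesis v_left : forall f, vdot (step f) = lam * vdot f.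
Local Notation growth := (growth L c lam u v).
Local Notation gap_density := (gap_density L c lam u).

Let lam_gt0 : 0 < lam. Proof. exact: lt_trans lam_gt1. Qed.

Lemma eq_growth al a b : (forall i, (1 <= i <= L)%N -> a i = b i) ->
  growth al a -> growth al b.
Proof. by move=> ab ga i iL; rewrite -ab //; apply: ga. Qed.

Lemma growth1 : growth (fun=> 1%N) u.
Proof. by move=> i iL; apply: word_sum1_cvg. Qed.

Lemma growth_nonempty : growth (fun w => w != [::]) u.
Proof.
apply: (@eq_growth _ (fun i => lam^-1 * step u i)) => [i iL|].
  by rewrite u_right // mulKf // gt_eqF.
by apply: growth_cons growth1 _ => //.
Qed.

Lemma growth_zero_then_pos k : growth (zero_then_pos k) (gap_density k).
Proof.
elim: k => [|k IHk].
  by apply: growth_cons growth1 _ => // x w; rewrite muln1.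
by apply: growth_cons IHk _ => // x w; rewrite /= /zero_digit mulnb.
Qed.

Lemma growth_gap_tail k :
  growth (gap_tail k) (if k is k'.+1 then gap_density k' else u).
Proof. by case: k => [|k]; [apply: growth_nonempty|apply: growth_zero_then_pos]. Qed.

Lemma mean_gaps_of_length_cvg k :
  (fun n => n%:R^-1 * mean_gaps_of_length R L c G n k) @ \oo -->
  vdot (transfer (gap_head k) (if k is k'.+1 then gap_density k' else u)) /
    lam / vdot u.
Proof.
have om0 : gap_head k 0 = 0%N by case: k.
have fE n w : size w = n.+1 ->
    gaps_of_length n (nth 0%N w) k = total (gap_head k) (gap_tail k) w.
  by move=> sw; rewrite -gaps_of_length_total sw.
exact: (@mean_total_cvg R L c G L_gt0 c1_gt0 cL_gt0 recG lam u v lam_gt1 u_gt0 v_gt0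
  u_right v_left _ _ _ (fun X n => gaps_of_length n X k) om0 (@growth_gap_tail k) fE).
Qed.

Lemma expectationQ_dist n (f g : nat -> R) K : 0 <= K ->
  (forall N, (G n.+1 <= N < G n.+2)%N -> `|f N - g N| <= K) ->
  `|expectationQ G n f - expectationQ G n g| <= K.
Proof.
move=> K0 fg; rewrite /expectationQ -mulrBl -sumrB normrM normfV normr_nat.
have [->|d0] := posnP (G n.+2 - G n.+1); first by rewrite invr0 mulr0.
rewrite ler_pdivrMr ?ltr0n //; apply: le_trans (ler_norm_sum _ _ _) _.
apply: le_trans (ler_sum_nat fg) _.
by rewrite sumr_const_nat mulr_natr.
Qed.

(** By [gaps_sumn] the total number of gaps may be replaced by the digit sum. *)
Lemma mean_gaps_cvg :
  (fun n => n%:R^-1 * mean_gaps R L c G n) @ \oo -->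
  vdot (transfer id u) / lam / vdot u.
Proof.
pose digit_sum (X : nat -> nat) n := (\sum_(0 <= j < n.+1) X j)%N.
have digit_sumE n w : size w = n.+1 -> digit_sum (nth 0%N w) n = sumn w.
  by move=> sw; rewrite sumnE (big_nth 0%N) sw.
pose S n := expectationQ G n (fun N => (digit_sum (digit L c G N) n)%:R : R).
have Slim : (fun n => n%:R^-1 * S n) @ \oo --> vdot (transfer id u) / lam / vdot u.
  apply: (@mean_total_cvg R L c G L_gt0 c1_gt0 cL_gt0 recG lam u v lam_gt1 u_gt0
    v_gt0 u_right v_left id _ _ digit_sum erefl growth1).
  by move=> n w sw; rewrite digit_sumE // sumn_as_total.
have dist n : `|mean_gaps R L c G n - S n| <= (cmax L c).+1%:R.
  apply: expectationQ_dist => // N NG.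
  have : N \in map (value G) (leading_words L c n).
    rewrite value_leading_words // mem_iota subnKC //.
    by have := G_homo L_gt0 c1_gt0 recG (leqnSn n).
  case/mapP => w wn ->.
  have -> : digit L c G (value G w) = nth 0%N w.
    by apply/funext => j; apply: digit_value wn j.
  have ww : w \in words L c n.+1 1 by rewrite words1_split // mem_cat wn orbT.
  have sw : size w = n.+1 by move: ww; rewrite mem_words => /andP[/eqP].
  have /andP[lo hi] := gaps_sumn ww L_gt0.
  rewrite digit_sumE // distrC -natrB // normr_nat ler_nat; lia.
rewrite -[X in _ --> X]addr0.
rewrite [X in X @ _](_ : _ =
   fun n => n%:R^-1 * S n + n%:R^-1 * (mean_gaps R L c G n - S n)); last first.
  by apply/funext => n; rewrite -mulrDr addrC subrK.
apply: cvgD => //.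
apply: (@cvg_dist_le _ _ (fun n => n%:R^-1 * (cmax L c).+1%:R)) => [n|].
  by rewrite subr0 normrM ger0_norm ?invr_ge0 // ler_wpM2l // invr_ge0.
by rewrite -(mul0r (cmax L c).+1%:R); apply: cvgMl; apply: cvg_invn.
Qed.

End GapLimits.

(** * The chain on the edges of the automaton *)

Section CalL.
Variables (L : nat) (c : nat -> nat).

Definition edge (x j j' : nat) : bool :=
  (0 < j <= L)%N &&
  ((x < c j)%N && (j' == 1%N) || [&& (j < L)%N, x == c j & j' == j.+1]).

Lemma calL_edge (z : calL L c) : edge (coord1 z) (coord2 z) (coord3 z).
Proof.
case: z => [[[x j] j'] /= zL]; rewrite /coord1 /coord2 /coord3 /edge /=.
by case/and3P: (zL) => -> _ ->; rewrite -ltnS ltn_ord.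
Qed.

Lemma calL_ex x j j' : edge x j j' ->
  exists z : calL L c, [/\ coord1 z = x, coord2 z = j & coord3 z = j'].
Proof.
move=> /andP[jL xjj].
have xm : (x < (cmax L c).+1)%N.
  rewrite ltnS; apply: leq_trans (_ : c j <= _)%N.
    by case/orP: xjj => [/andP[/ltnW]|/and3P[_ /eqP ->]].
  by apply: (leq_bigmax_seq (F := c) j) => //; rewrite mem_index_iota ltnS.
have j'L : (0 < j' < L.+1)%N.
  by case/orP: xjj => [/andP[_ /eqP ->]|/and3P[jL' _ /eqP ->]]; lia.
have jL' : (j < L.+1)%N by case/andP: jL.
have j'L' : (j' < L.+1)%N by case/andP: j'L.
have zL : in_calL (Ordinal xm, Ordinal jL', Ordinal j'L').
  by rewrite /in_calL /= xjj; case/andP: jL => ->; case/andP: j'L => ->.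
by exists (exist (fun t => is_true (in_calL t)) _ zL).
Qed.

Lemma calL_inj (z z' : calL L c) : coord1 z = coord1 z' ->
  coord2 z = coord2 z' -> coord3 z = coord3 z' -> z = z'.
Proof.
case: z => [[[a1 a2] a3] ?]; case: z' => [[[b1 b2] b3] ?].
rewrite /coord1 /coord2 /coord3 /= => /ord_inj e1 /ord_inj e2 /ord_inj e3.
by apply: val_inj => /=; rewrite e1 e2 e3.
Qed.

Lemma sum_calL (V : nmodType) (F : nat -> nat -> nat -> V) :
  \sum_(z : calL L c) F (coord1 z) (coord2 z) (coord3 z) =
  \sum_(1 <= i < L.+1) (\sum_(0 <= x < c i) F x i 1%N +
                        (if (i < L)%N then F (c i) i i.+1 else 0)).
Proof.
pose s1 := [seq (x, i, 1%N) | i <- index_iota 1 L.+1, x <- index_iota 0 (c i)].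
pose s2 := [seq (c i, i, i.+1) | i <- index_iota 1 L].
pose coords (z : calL L c) := (coord1 z, coord2 z, coord3 z).
have -> : \sum_(z : calL L c) F (coord1 z) (coord2 z) (coord3 z) =
    \sum_(t <- map coords (index_enum (calL L c))) F t.1.1 t.1.2 t.2.
  by rewrite big_map.
have perm : perm_eq (map coords (index_enum (calL L c))) (s1 ++ s2).
  apply: uniq_perm.
  - rewrite map_inj_uniq ?index_enum_uniq // => z z' [].
    exact: calL_inj.
  - rewrite cat_uniq; apply/and3P; split.
    + apply: allpairs_uniq_dep => [|i _|[i x] [i' x'] _ _ /= [-> ->] //].
        exact: iota_uniq.
      exact: iota_uniq.
    + apply/hasPn => t /mapP[i + ->]; rewrite mem_index_iota => iL.
      by apply/negP => /allpairsPdep[? [? [_ _ [_ _]]]]; lia.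
    + by rewrite map_inj_uniq ?iota_uniq // => i i' [].
  move=> [[x j] j']; rewrite mem_cat.
  have -> : (x, j, j') \in map coords (index_enum (calL L c)) = edge x j j'.
    apply/mapP/idP => [[z _ [-> -> ->]]|/calL_ex[z [<- <- <-]]].
      exact: calL_edge.
    by exists z; rewrite ?mem_index_enum.
  rewrite /edge andb_orr; congr (_ || _).
    apply/idP/allpairsPdep => [/and3P[jL xc /eqP ->]|[i [y [+ + [-> -> ->]]]]].
      by exists j, x; rewrite !mem_index_iota.
    by rewrite !mem_index_iota ltnS => -> /andP[_ ->] /=.
  apply/idP/mapP => [/and4P[jL jL' /eqP -> /eqP ->]|[i + [-> -> ->]]].
    by exists j => //; rewrite mem_index_iota; lia.
  by rewrite mem_index_iota !eqxx => iL; lia.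
rewrite (perm_big _ perm) big_cat /= big_allpairs_dep big_map /= big_split /=.
congr (_ + _); case: (posnP L) => [->|L_gt0]; first by rewrite !big_geq.
rewrite [RHS]big_nat_recr //= ltnn addr0.
by apply: eq_big_nat => i /andP[_ ->].
Qed.

Lemma sum_nat_pick (V : nmodType) (F : nat -> V) i : (0 < i <= L)%N ->
  \sum_(1 <= j < L.+1) (if j == i then F j else 0) = F i.
Proof.
move=> iL; rewrite (bigD1_seq i) ?iota_uniq ?mem_index_iota //= eqxx.
by rewrite big1 ?addr0 // => j /negbTE ->.
Qed.

End CalL.

Section Chain.
Variables (R : realType) (L : nat) (c : nat -> nat) (lamc : R).
Variables (nuc : 'rV[R]_#|{: calL L c}|) (phic : 'cV[R]_#|{: calL L c}|).
Hypotheses (L_gt0 : (0 < L)%N) (c1_gt0 : (0 < c 1)%N) (cL_gt0 : (0 < c L)%N).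
Hypothesis lamc_gt0 : 0 < lamc.
Hypothesis hnuc : nuc *m P_calL R L c = lamc *: nuc.
Hypothesis hphic : P_calL R L c *m phic = lamc *: phic.
Hypothesis nuc_gt0 : forall i, 0 < nuc 0 i.
Hypothesis phic_gt0 : forall i, 0 < phic i 0.
Hypothesis pi_sum : \sum_(z : calL L c) piQ nuc phic z = 1.
Local Notation transfer := (transfer_op L c).
Local Notation step := (transfer (fun=> 1%N)).

Definition inv_entry : R := ((cmax L c).+1 * L)%N%:R.
(** The common eigenvalue of u, v and the companion matrix. *)
Definition growth_rate : R := inv_entry * lamc.
Definition right_vec (j : nat) : R :=
  \sum_(z : calL L c | coord2 z == j) phic (enum_rank z) 0.
Definition left_vec (j : nat) : R :=
  \sum_(z : calL L c | coord3 z == j) nuc 0 (enum_rank z).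
Notation lam := growth_rate.
Notation u := right_vec.
Notation v := left_vec.
Local Notation vdot := (weighted_sum L v).

Lemma inv_entry_gt0 : 0 < inv_entry.
Proof. by rewrite ltr0n muln_gt0 L_gt0. Qed.

Lemma growth_rate_gt0 : 0 < lam.
Proof. by rewrite mulr_gt0 ?inv_entry_gt0. Qed.

Let lamN0 : lam != 0. Proof. by rewrite gt_eqF // growth_rate_gt0. Qed.

Lemma sum_enum_rank (F : 'I_#|{: calL L c}| -> R) :
  \sum_i F i = \sum_(z : calL L c) F (enum_rank z).
Proof. by rewrite (reindex enum_rank) //; apply/onW_bij/enum_rank_bij. Qed.

Lemma phicE z : phic (enum_rank z) 0 = u (coord3 z) / lam.
Proof.
have /matrixP/(_ (enum_rank z) 0) := hphic; rewrite !mxE sum_enum_rank => E.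
have {}E : inv_entry^-1 * u (coord3 z) = lamc * phic (enum_rank z) 0.
  rewrite -E mulr_sumr big_mkcond; apply: eq_bigr => z' _.
  by rewrite mxE !enum_rankK eq_sym; case: ifP; rewrite ?mul0r.
rewrite -[LHS](mulKf (lt0r_neq0 lamc_gt0)) -E /growth_rate invfM.
ring.
Qed.

Lemma nucE z : nuc 0 (enum_rank z) = v (coord2 z) / lam.
Proof.
have /matrixP/(_ 0 (enum_rank z)) := hnuc; rewrite !mxE sum_enum_rank => E.
have {}E : inv_entry^-1 * v (coord2 z) = lamc * nuc 0 (enum_rank z).
  rewrite -E mulr_sumr big_mkcond; apply: eq_bigr => z' _.
  by rewrite mxE !enum_rankK mulrC; case: ifP; rewrite ?mulr0.
rewrite -[LHS](mulKf (lt0r_neq0 lamc_gt0)) -E /growth_rate invfM.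
ring.
Qed.

Lemma piQE z : piQ nuc phic z = v (coord2 z) * u (coord3 z) / lam ^+ 2.
Proof. by rewrite /piQ nucE phicE; field. Qed.

Lemma right_vec_gt0 i : (1 <= i <= L)%N -> 0 < u i.
Proof.
move=> iL; have [z zi] : exists z : calL L c, coord2 z = i.
  have [ci|ci] := posnP (c i).
    have iL' : (i < L)%N.
      rewrite ltn_neqAle (andP iL).2 andbT.
      by apply: contra_eqN ci => /eqP ->; rewrite -lt0n.
    have [|z [_ <- _]] := @calL_ex L c 0%N i i.+1; last by exists z.
    by rewrite /edge iL iL' ci !eqxx orbT.
  have [|z [_ <- _]] := @calL_ex L c 0%N i 1%N; last by exists z.
  by rewrite /edge iL ci eqxx.
rewrite /right_vec (bigD1 z) ?zi //= ltr_wpDr // sumr_ge0 // => z' _.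
exact: ltW.
Qed.

Lemma left_vec_gt0 i : (1 <= i <= L)%N -> 0 < v i.
Proof.
move=> iL; have [z zi] : exists z : calL L c, coord3 z = i.
  case: i iL => // -[|i] iL.
    have [|z [_ _ <-]] := @calL_ex L c 0%N 1%N 1%N; last by exists z.
    by rewrite /edge L_gt0 c1_gt0 eqxx.
  have [|z [_ _ <-]] := @calL_ex L c (c i.+1) i.+1 i.+2; last by exists z.
  by rewrite /edge !eqxx (_ : i.+1 < L)%N ?orbT ?andbT //; lia.
rewrite /left_vec (bigD1 z) ?zi //= ltr_wpDr // sumr_ge0 // => z' _.
exact: ltW.
Qed.

Lemma right_vec_right i : (1 <= i <= L)%N -> step u i = lam * u i.
Proof.
move=> iL; have -> : lam * u i =
    \sum_(z : calL L c) (if coord2 z == i then u (coord3 z) else 0).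
  rewrite /right_vec mulr_sumr big_mkcond; apply: eq_bigr => z _.
  by case: ifP => // _; rewrite phicE mulrC divfK.
rewrite (@sum_calL L c _ (fun x j j' => if j == i then u j' else 0)).
rewrite -[LHS](sum_nat_pick (step u) iL); apply: eq_bigr => j _.
case: (j == i); last by rewrite big1 // if_same addr0.
by rewrite stepE sumr_const_nat subn0 mulr_natl.
Qed.

Lemma vdot_transfer om a :
  vdot (transfer om a) =
  \sum_(z : calL L c) (om (coord1 z))%:R * (v (coord2 z) * a (coord3 z)).
Proof.
rewrite (@sum_calL L c _ (fun x j j' => (om x)%:R * (v j * a j'))).
apply: eq_bigr => i _; move: (v i) => vi.
rewrite /transfer_op mulrDr natr_sum mulr_suml mulr_sumr.
by congr (_ + _); [apply: eq_bigr => x _|case: ifP => _]; ring.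
Qed.

Lemma left_vec_left f : vdot (step f) = lam * vdot f.
Proof.
rewrite vdot_transfer.
have -> : vdot f = \sum_(z : calL L c) nuc 0 (enum_rank z) * f (coord3 z).
  rewrite /weighted_sum; under eq_bigr do rewrite /left_vec mulr_suml big_mkcond.
  rewrite exchange_big; apply: eq_bigr => z _ /=.
  rewrite -[RHS](@sum_nat_pick L _ (fun j => nuc 0 (enum_rank z) * f j)).
    by apply: eq_bigr => j _; rewrite eq_sym.
  by have := calL_edge z; rewrite /edge; lia.
rewrite mulr_sumr; apply: eq_bigr => z _.
by rewrite nucE mul1r mulrA [lam * _]mulrC divfK.
Qed.

(** The normalization of [piQ]. *)
Lemma vdot_right_vec : vdot u = lam.
Proof.
have sumE : \sum_(z : calL L c) v (coord2 z) * u (coord3 z) = lam * vdot u.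
  by rewrite -left_vec_left vdot_transfer; apply: eq_bigr => z _; rewrite mul1r.
have E : lam * vdot u / lam ^+ 2 = 1.
  by rewrite -sumE mulr_suml -[RHS]pi_sum; apply: eq_bigr => z _; rewrite piQE.
have -> : vdot u = lam * vdot u / lam ^+ 2 * lam by field.
by rewrite E mul1r.
Qed.

Lemma sum_piQ_coord1 om :
  \sum_(z : calL L c) (om (coord1 z))%:R * piQ nuc phic z =
  vdot (transfer om u) / lam ^+ 2.
Proof.
rewrite vdot_transfer mulr_suml; apply: eq_bigr => z _.
by rewrite piQE !mulrA.
Qed.

Lemma M_piQ1E : M_piQ1 nuc phic = vdot (transfer id u) / lam ^+ 2.
Proof.
rewrite -sum_piQ_coord1 /M_piQ1 [RHS](partition_big (fun z => (val z).1.1) xpredT) //=.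
apply: eq_bigr => x _; rewrite /piQ1 mulr_sumr.
by apply: eq_bigr => z /eqP <-.
Qed.

Lemma piQ1_0E : piQ1 nuc phic 0 = vdot (transfer zero_digit u) / lam ^+ 2.
Proof.
rewrite -sum_piQ_coord1 /piQ1 big_mkcond; apply: eq_bigr => z _.
by rewrite /zero_digit; case: eqP => _; rewrite ?mul1r ?mul0r.
Qed.

Lemma sum_H1 :
  \sum_(z in H1 L c) piQ nuc phic z =
  (\sum_(1 <= i < L.+1 | (0 < c i)%N) v i) * u 1%N / lam ^+ 2.
Proof.
rewrite big_mkcond.
pose F (x j j' : nat) : R := if (x == 0%N) && (j' == 1%N) then v j * u j' / lam ^+ 2 else 0.
rewrite (eq_bigr (fun z : calL L c => F (coord1 z) (coord2 z) (coord3 z))); last first.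
  by move=> z _; rewrite inE piQE.
rewrite (@sum_calL L c _ F) -mulrA mulr_suml [RHS]big_mkcond.
apply: eq_big_nat => i iL; rewrite [if (i < L)%N then _ else _](_ : _ = 0); last first.
  by rewrite /F eqSS; case: i iL => // i _; rewrite andbF if_same.
rewrite addr0; case: posnP => [->|ci]; first by rewrite big_geq.
by rewrite big_ltn // big_nat big1 ?addr0 ?mulrA // => -[].
Qed.

(** The element (0, b + 1, b + 2) has the weight v (b + 1) * u (b + 2), which
equals v b * u (b + 1) as both eigenvector equations reduce to one term there. *)
Lemma sum_H2 (Phi : nat -> R) :
  \sum_(z in H2 L c) piQ nuc phic z * Phi (coord2 z - 1)%N =
  (\sum_(1 <= b < L | (0 < c b)%N && (c b.+1 == 0%N)) v b * (u b.+1 * Phi b))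
    / lam ^+ 2.
Proof.
rewrite big_mkcond.
pose F (x j j' : nat) : R := if [&& x == 0%N, j == j.-1.+1, j' == j.-1.+2, (1 <= j.-1)%N,
    (0 < c j.-1)%N & c j.-1.+1 == 0%N]
  then v j * u j' / lam ^+ 2 * Phi j.-1 else 0.
rewrite (eq_bigr (fun z : calL L c => F (coord1 z) (coord2 z) (coord3 z))); last first.
  by move=> z _; rewrite inE piQE subn1.
rewrite (@sum_calL L c _ F) big_ltn // big_add1 /= /F /= !andbF if_same.
rewrite big1 => [|x _]; last by rewrite !andbF.
rewrite !add0r mulr_suml [RHS]big_mkcond; apply: eq_big_nat => b bL.
rewrite big1 => [|x _]; last by rewrite !andbF.
rewrite add0r !eqxx /=; have b0 : (0 < b)%N by case/andP: bL.
rewrite b0 /=; case: (posnP (c b)) => cb; first by rewrite andbF if_same.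
have [cb1|] := boolP (c b.+1 == 0%N); last by rewrite if_same.
have [bL1 _] := zero_runS cL_gt0 (andP bL).2 (eqP cb1).
have vb : v b = lam * v b.+1.
  exact: (left_eigen_succ L_gt0 c1_gt0 cL_gt0 growth_rate_gt0 left_vec_left).
have ub : u b.+2 = lam * u b.+1.
  by apply: (right_eigen_zero L_gt0 c1_gt0 cL_gt0 growth_rate_gt0 right_vec_right); lia.
by rewrite bL1 vb ub; ring.
Qed.

Lemma mk_calLE x j j' : edge L c x j j' ->
  exists2 z, mk_calL L c x j j' = Some z &
    [/\ coord1 z = x, coord2 z = j & coord3 z = j'].
Proof.
move=> /calL_ex[z [zx zj zj']]; rewrite /mk_calL; case: pickP => [z'|].
  by case/and3P => /eqP ? /eqP ? /eqP ?; exists z'.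
by move/(_ z); rewrite zx zj zj' !eqxx.
Qed.

Lemma rhoE b : (1 <= b < L)%N -> c b.+1 = 0%N ->
  rho lamc phic b = run_exit L c lam u b.
Proof.
move=> bL cb; have bL' := (andP bL).2.
have [rL cr zs] := zero_runP cL_gt0 bL'; have [_ rE] := zero_runS cL_gt0 bL' cb.
rewrite /rho !addn1.
have [|z -> [_ _ z3]] := @mk_calLE 0 (b + zero_run L c b) (b + zero_run L c b).+1.
  by rewrite /edge rL zs ?rE ?leqnn // !eqxx orbT andbT; lia.
have [|z' -> [_ z'2 z'3]] := @mk_calLE 0 (b + zero_run L c b).+1 1.
  by rewrite /edge cr eqxx /= rL.
rewrite /Qmx mxE !enum_rankK z3 z'2 eqxx !phicE z3 z'3 /run_exit /growth_rate.
have ue : u (b + zero_run L c b).+1 != 0 by rewrite gt_eqF // right_vec_gt0.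
have := lt0r_neq0 inv_entry_gt0; rewrite -/inv_entry; move: inv_entry => K K0.
by field; rewrite ue K0 lt0r_neq0.
Qed.

End Chain.

(** * The limiting distribution of gap lengths *)

(** The equation in state i determines the entry i + 1 from the entries i
and 1. *)
Lemma eigenvector_ratio (R : realType) (L : nat) (c : nat -> nat) (lam : R) (u p : nat -> R) :
  (forall i, (1 <= i <= L)%N -> transfer_op L c (fun=> 1%N) u i = lam * u i) ->
  (forall i, (1 <= i <= L)%N -> transfer_op L c (fun=> 1%N) p i = lam * p i) ->
  forall i, (1 <= i <= L)%N -> p i * u 1%N = u i * p 1%N.
Proof.
move=> ue pe; elim=> // -[|i] IHi iL; first by rewrite mulrC.
have iL' : (1 <= i.+1 <= L)%N by lia.
have iL2 : (i.+1 < L)%N by lia.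
have := ue _ iL'; have := pe _ iL'; rewrite !stepE iL2.
move=> /(canRL (addKr _)) -> /(canRL (addKr _)) ->.
by have := IHi iL' => E; rewrite !mulrDl -!mulrA E; ring.
Qed.

(** States are numbered from 1, the entries of a column vector from 0. *)
Definition state_vec (R : realType) (L : nat) (x : 'cV[R]_L) (j : nat) : R :=
  if insub j.-1 is Some i then x i 0 else 0.

Lemma state_vecE (R : realType) (L : nat) (x : 'cV[R]_L) (i : 'I_L) :
  state_vec x i.+1 = x i 0.
Proof. by rewrite /state_vec /= valK. Qed.

Lemma companion_right (R : realType) (L : nat) (c : nat -> nat) (lam : R)
    (x : 'cV[R]_L) : companion R L c *m x = lam *: x ->
  forall i, (1 <= i <= L)%N ->
  transfer_op L c (fun=> 1%N) (state_vec x) i = lam * state_vec x i.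
Proof.
move=> xE [|i] // iL; have /matrixP/(_ (Ordinal iL) 0) := xE.
rewrite !mxE -state_vecE /= => <-; rewrite stepE.
pose F (k : nat) := if k == 0%N then (c i.+1)%:R * state_vec x 1
                    else if k == i.+1 then state_vec x k.+1 else 0.
rewrite (eq_bigr (fun k : 'I_L => F k)) => [|k _]; last first.
  rewrite !mxE -state_vecE /F /=; case: eqP => [->//|_].
  by case: ifP; rewrite ?mul1r ?mul0r.
rewrite -(big_mkord xpredT F) big_ltn; last by apply: leq_ltn_trans iL.
rewrite [F 0%N]/F /=; congr (_ + _).
rewrite (eq_big_nat _ _ (F2 := fun k => if k == i.+1 then state_vec x k.+1 else 0)).
  case: ifP => iL'; last first.
    by rewrite big_nat big1 // => k kL; rewrite ifF //; lia.
  rewrite (bigD1_seq i.+1) ?iota_uniq ?mem_index_iota //= eqxx.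
  by rewrite big1 ?addr0 // => k /negbTE ->.
by move=> k /andP[k0 _]; rewrite /F gtn_eqF.
Qed.

(** State 1 has at least two outgoing edges, which makes lam > 1. *)
Lemma branching_cases (L : nat) (c : nat -> nat) :
  (0 < L)%N -> (0 < c 1)%N -> (L, c 1) <> (1, 1) ->
  (1 < L)%N \/ L = 1%N /\ (1 < c 1)%N.
Proof.
move=> L_gt0 c1_gt0 Lc; have [L2|L1] := ltnP 1 L; first by left.
have L_eq : L = 1%N by apply/eqP; rewrite eqn_leq L1.
right; split=> //; rewrite ltn_neqAle c1_gt0 andbT eq_sym.
by apply/eqP => c1E; apply: Lc; rewrite L_eq c1E.
Qed.

Theorem theorem4p1 (R : realType) (L : nat) (c G : nat -> nat)
    (lamc : R)
    (nuc : 'rV[R]_#|{: calL L c}|) (phic : 'cV[R]_#|{: calL L c}|)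
    (lamC : R) (phiC : 'cV[R]_L)
    (hL : (0 < L)%N) (hc : (0 < c 1%N * c L)%N)
    (hLc : (L, c 1%N) <> (1%N, 1%N))
    (hG : positive_linear_recursion L c G)
    (hlamc : perron_eigenvalue (P_calL R L c) lamc)
    (hnuc : nuc *m P_calL R L c = lamc *: nuc)
    (hphic : P_calL R L c *m phic = lamc *: phic)
    (hnuc_pos : forall i, 0 < nuc 0 i)
    (hphic_pos : forall i, 0 < phic i 0)
    (hphic_sum : \sum_(z : calL L c) phic (enum_rank z) 0 = 1)
    (hpi_sum : \sum_(z : calL L c) piQ nuc phic z = 1)
    (hlamC : perron_eigenvalue (companion R L c) lamC)
    (hphiC : companion R L c *m phiC = lamC *: phiC)
    (hphiC_pos : forall i, 0 < phiC i 0) :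
  [/\ (forall (z : calL L c) (i1 i2 : 'I_L),
         z \in H2 L c ->
         let b := (coord2 z).-1 in
         i1.+1 = 1%N -> i2.+1 = (b + zero_run L c b + 1)%N ->
         rho lamc phic b = phiC i1 0 / (lamC * phiC i2 0)),
      (fun n : nat => n%:R^-1 * mean_gaps R L c G n) @ \oo
        --> M_piQ1 nuc phic,
      (fun n : nat => mu R L c G n 0) @ \oo
        --> 1 - (1 - piQ1 nuc phic 0) / M_piQ1 nuc phic,
      (fun n : nat => mu R L c G n 1) @ \oo
        --> (1 - piQ1 nuc phic 0
               - (\sum_(z in H1 L c) piQ nuc phic z) * (1 - lamC^-1)
               - \sum_(z in H2 L c)
                   piQ nuc phic z * (1 - rho lamc phic (coord2 z - 1)))
            / M_piQ1 nuc phic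
    & forall k : nat, (2 <= k)%N ->
      (fun n : nat => mu R L c G n k) @ \oo
        --> ((1 - lamC^-1) * (\sum_(z in H1 L c) piQ nuc phic z)
                * nu lamC (k - 1)
               + \sum_(z in H2 L c)
                   piQ nuc phic z
                   * (h lamc phic lamC (coord2 z - 1) k
                      - rho lamc phic (coord2 z - 1) * nu lamC (k - 1)))
            / M_piQ1 nuc phic].
Proof.
have [c1_gt0 cL_gt0] : (0 < c 1)%N /\ (0 < c L)%N by apply/andP; rewrite -muln_gt0.
have [lamc_gt0 _ _] := hlamc; have [lamC_gt0 _ _] := hlamC.
set lam := growth_rate L c lamc.
set u := right_vec phic; set v := left_vec nuc.
have u_gt0 : forall i, (1 <= i <= L)%N -> 0 < u i by apply: right_vec_gt0.
have v_gt0 : forall i, (1 <= i <= L)%N -> 0 < v i by apply: left_vec_gt0.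
have u_right : forall i, (1 <= i <= L)%N -> transfer_op L c (fun=> 1%N) u i = lam * u i.
  exact: right_vec_right.
have v_left : forall f, weighted_sum L v (transfer_op L c (fun=> 1%N) f) = lam * weighted_sum L v f.
  exact: left_vec_left.
have vu : weighted_sum L v u = lam by apply: vdot_right_vec.
pose p := state_vec phiC.
have pE (i : 'I_L) : p i.+1 = phiC i 0 by apply: state_vecE.
have p_right i : (1 <= i <= L)%N ->
    transfer_op L c (fun=> 1%N) p i = lamC * p i.
  by move=> iL; apply: companion_right hphiC _ iL.
have p_gt0 i : (1 <= i <= L)%N -> 0 < p i.
  by case: i => // i iL; have := pE (Ordinal iL); rewrite /= => ->.
(* pairing with v: p and u have a positive pairing, so their eigenvalues agree *)
have lamE : lamC = lam.
  have vp := vdot_gt0 v_gt0 hL p_gt0.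
  apply: (mulIf (lt0r_neq0 vp)); rewrite -v_left -vdotZ.
  by apply: eq_vdot => i iL; rewrite p_right.
have L1 : (1 <= 1 <= L)%N by rewrite hL.
have u1 := u_gt0 _ L1.
have branching := branching_cases hL c1_gt0 hLc.
have lam_gt1 : 1 < lam.
  rewrite -(ltr_pM2r u1) mul1r -u_right // stepE.
  have c1R : 1 <= (c 1)%:R :> R by rewrite ler1n.
  case: branching => [L2|[-> c1_gt1]].
    have u2 : 0 < u 2 by apply: u_gt0.
    by rewrite L2; nra.
  by rewrite ltnn addr0 ltr_pMl // ltr1n.
have lam_gt0 : 0 < lam by apply: lt_trans lam_gt1.
have lamN0 := lt0r_neq0 lam_gt0.
have H2sum Phi : \sum_(z in H2 L c) piQ nuc phic z * Phi (coord2 z - 1)%N =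
    (\sum_(1 <= b < L | (0 < c b)%N && (c b.+1 == 0%N)) v b * (u b.+1 * Phi b))
      / lam ^+ 2.
  exact: sum_H2.
have rho_exit b : (1 <= b < L)%N -> c b.+1 = 0%N ->
    rho lamc phic b = run_exit L c lam u b.
  exact: rhoE.
have M_E : M_piQ1 nuc phic = weighted_sum L v (transfer_op L c id u) / lam ^+ 2.
  exact: M_piQ1E.
have M_gt0 : 0 < M_piQ1 nuc phic.
  have id_ge0 i : (1 <= i <= L)%N -> 0 <= transfer_op L c id u i.
    by apply: transfer_ge0 => // j jL; rewrite ltW // u_gt0.
  rewrite M_E divr_gt0 ?exprn_gt0 // /weighted_sum big_ltn //.
  rewrite ltr_wpDr ?mulr_gt0 ?v_gt0 //.
    rewrite big_nat sumr_ge0 // => i iL.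
    by rewrite mulr_ge0 ?id_ge0 // ?ltW ?v_gt0 //; lia.
  rewrite /transfer_op; case: branching => [L2|[-> c1_gt1]].
    have u2 : 0 < u 2 by apply: u_gt0.
    rewrite L2; apply: ltr_wpDl; first by rewrite mulr_ge0 ?ler0n // ltW.
    by rewrite mulr_gt0 ?ltr0n.
  rewrite ltnn addr0 mulr_gt0 // ltr0n.
  by rewrite (bigD1_seq 1%N) ?iota_uniq ?mem_index_iota.
have pos_E : 1 - piQ1 nuc phic 0 = weighted_sum L v (transfer_op L c pos_digit u) / lam ^+ 2.
  have -> : piQ1 nuc phic 0 = weighted_sum L v (transfer_op L c zero_digit u) / lam ^+ 2.
    exact: piQ1_0E.
  by rewrite (vdot_transfer_pos_digitB v_left) vu; field.
have M_lim : (fun n => n%:R^-1 * mean_gaps R L c G n) @ \oo --> M_piQ1 nuc phic.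
  rewrite M_E expr2 invfM mulrA -[X in _ / X]vu.
  exact: (mean_gaps_cvg hL c1_gt0 cL_gt0 hG lam_gt1 u_gt0 v_gt0 u_right v_left).
pose dens k := if k is k'.+1 then gap_density L c lam u k' else u.
have mu_lim k : (fun n => mu R L c G n k) @ \oo -->
    weighted_sum L v (transfer_op L c (gap_head k) (dens k)) / lam ^+ 2 / M_piQ1 nuc phic.
  have k_lim : (fun n => n%:R^-1 * mean_gaps_of_length R L c G n k) @ \oo -->
      weighted_sum L v (transfer_op L c (gap_head k) (dens k)) / lam ^+ 2.
    rewrite expr2 invfM mulrA -[X in _ / X]vu.
    exact: (mean_gaps_of_length_cvg hL c1_gt0 cL_gt0 hG lam_gt1 u_gt0 v_gt0 u_right v_left).
  (* the factor 1 / n can be inserted only for n > 0 *)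
  rewrite -cvg_shiftS /=.
  rewrite [X in X @ _](_ : _ = fun n =>
     (n.+1%:R^-1 * mean_gaps_of_length R L c G n.+1 k) /
     (n.+1%:R^-1 * mean_gaps R L c G n.+1)); last first.
    apply/funext => n; have n0 : n.+1%:R^-1 != 0 :> R by rewrite invr_eq0 pnatr_eq0.
    rewrite /mu; move: (mean_gaps_of_length _ _ _ _ _ _) (mean_gaps _ _ _ _ _) => x y.
    by rewrite -mulf_div divff // mul1r.
  rewrite (cvg_shiftS (fun n => (n%:R^-1 * mean_gaps_of_length R L c G n k) /
     (n%:R^-1 * mean_gaps R L c G n))).
  exact: (cvgM k_lim (cvgV (lt0r_neq0 M_gt0) M_lim)).
split=> //.
- move=> z i1 i2 zH2 b i1E i2E.
  have [bL cb] : (1 <= b < L)%N /\ c b.+1 = 0%N.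
    have := calL_edge z; move: zH2; rewrite inE -/b.
    case/and5P=> _ /eqP zb /eqP zb' b1 /andP[_ /eqP cb]; rewrite /edge zb zb' => /andP[].
    by split=> //; lia.
  rewrite rho_exit // /run_exit -/lam lamE -(pE i1) -(pE i2) i1E i2E addn1.
  have eL : (1 <= (b + zero_run L c b).+1 <= L)%N.
    by have := ltn_ord i2; rewrite i2E addn1 => ->.
  have := eigenvector_ratio u_right (p := p) _ eL; rewrite -lamE => /(_ p_right) E.
  apply/eqP; rewrite eqr_div ?mulf_neq0 ?lt0r_neq0 ?u_gt0 ?p_gt0 //; apply/eqP.
  by rewrite mulrCA [u 1%N * _]mulrC E; ring.
- rewrite (_ : _ - _ =
    weighted_sum L v (transfer_op L c (gap_head 0) (dens 0%N)) / lam ^+ 2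
      / M_piQ1 nuc phic) //.
  rewrite [gap_head 0]/= [dens 0%N]/= vdot_transfer_predn [in RHS]mulrBl -M_E -pos_E.
  by field; rewrite lt0r_neq0.
- rewrite (_ : _ / _ =
    weighted_sum L v (transfer_op L c (gap_head 1) (dens 1%N)) / lam ^+ 2
      / M_piQ1 nuc phic) //.
  congr (_ / _); rewrite [dens 1%N]/= pos_E lamE.
  rewrite (H2sum (fun b => 1 - rho lamc phic b)).
  rewrite (vdot_gap_density0 hL c1_gt0 cL_gt0 lam_gt0 u_gt0 u_right v_left).
  have -> : \sum_(z in H1 L c) piQ nuc phic z =
      (\sum_(1 <= i < L.+1 | (0 < c i)%N) v i) * u 1%N / lam ^+ 2.
    exact: sum_H1.
  rewrite !mulrBl [_ / lam ^+ 2 * _]mulrAC; congr (_ - _ / _).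
  rewrite big_nat_cond [RHS]big_nat_cond; apply: eq_bigr => b.
  by case/andP=> bL /andP[_ /eqP cb]; rewrite rho_exit.
- case=> [|[|k]] // _.
  rewrite (_ : _ / _ =
    weighted_sum L v (transfer_op L c (gap_head k.+2) (dens k.+2)) / lam ^+ 2
      / M_piQ1 nuc phic) //.
  congr (_ / _); rewrite [dens k.+2]/= lamE.
  rewrite (H2sum (fun b => h lamc phic lam b k.+2 - rho lamc phic b * nu lam (k.+2 - 1))).
  rewrite (vdot_gap_densityS hL c1_gt0 cL_gt0 lam_gt0 u_gt0 u_right v_left).
  have -> : \sum_(z in H1 L c) piQ nuc phic z =
      (\sum_(1 <= i < L.+1 | (0 < c i)%N) v i) * u 1%N / lam ^+ 2.
    exact: sum_H1.
  have nuE : nu lam (k.+2 - 1) = lam ^- k * (1 - lam^-1) by rewrite /nu !subn1.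
  rewrite nuE [in RHS]mulrDl; congr (_ + _ / _); first by ring.
  rewrite big_nat_cond [RHS]big_nat_cond; apply: eq_bigr => b.
  case/andP=> bL /andP[_ /eqP cb]; have bL' := (andP bL).2.
  rewrite (gap_density_start hL c1_gt0 cL_gt0 lam_gt0 u_gt0 u_right) //.
  rewrite /h rho_exit // -[u b.+1 * _ * _]mulrA -mulrBr; congr (_ * (_ * (_ - _))).
  rewrite addn1 ltnS eqSS; case: ifP => // _; case: ifP => // _.
  by congr (_ * _ ^- _ * _); lia.
Qed.
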